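(* $$\operatorname{Hilb}(\mathcal{Z}_{L,-1}):=\sum_{i,j}\dim\mathcal{Z}_{L,-1}^{i,j}\,q^it^j=(1+t)^r\,q^{n-r}\,T_L\!\left(\frac{1}{1+t},\frac1q\right).$$
   Context: Let $L$ be a complex vector space of dimension $r$, and let $\ell_1,\dots,\ell_n \in L^*$ be linear forms (possibly zero, possibly proportional) with zero loci $H_1,\dots,H_n$ satisfying $H_1\cap\dots\cap H_n=0$. Set $E=\{1,\dots,n\}$; for $A\subseteq E$ let $\operatorname{rk}(A)$ be the dimension of the span of $\{\ell_i\}_{i\in A}$. $T_L(x,y)=\sum_{A\subseteq E}(x-1)^{r-\operatorname{rk}(A)}(y-1)^{|A|-\operatorname{rk}(A)}$ is the Tutte polynomial of the matroid of the arrangement. Superspace: $\Psi_L=\operatorname{Sym}L\otimes\wedge^\bullet L$, bigraded by (commutative degree, anticommutative degree), with derivation $d$ (exterior derivative) of bidegree $(-1,1)$ with $d(v\otimes1)=1\otimes v$, $d(1\otimes v)=0$ for $v\in L$. The differential closure of a homogeneous ideal of $\operatorname{Sym}L$ is the smallest ideal of $\Psi_L$ containing it and closed under $d$. For $v\in L$, $\rho(v)$ is the number of $i$ with $v\notin H_i$. $\mathcal{Z}_{L,-1}=\bigoplus_{i,j}\mathcal{Z}_{L,-1}^{i,j}$ is the quotient of $\Psi_L$ by the differential closure of the ideal $(v^{\rho(v)}:v\in L\setminus\{0\})\subseteq\operatorname{Sym}L$; $i$ tracks the commutative and $j$ the anticommutative degree. *)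

(* Defs.v *)
From HB Require Import structures.
From mathcomp Require Import all_boot all_order all_algebra.
From mathcomp Require Import reals complex.
From mathcomp Require Import mpoly ring.

Set Implicit Arguments.
Unset Strict Implicit.
Unset Printing Implicit Defensive.

Import Order.TTheory GRing.Theory Num.Theory.
Local Open Scope ring_scope.

(* F[x_1..x_r] (x) /\(theta_1..theta_r): the function [w] encodes
   \sum_S w S (x) theta_S, with theta_S the wedge product of the theta_k,
   k \in S, in increasing order of k. *)
Definition superspace (F : fieldType) (r : nat) :=
  {ffun {set 'I_r} -> {mpoly F[r]}}.

HB.instance Definition _ (F : fieldType) (r : nat) :=
  GRing.Lmodule.copy (superspace F r) {ffun {set 'I_r} -> {mpoly F[r]}}.

(* theta_A theta_B = (-1) ^ inversions A B theta_(A :|: B) for disjoint A, B. *)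
Definition inversions (r : nat) (A B : {set 'I_r}) : nat :=
  (\sum_(a in A) \sum_(b in B) (b < a))%N.

Section SuperspaceRing.
Variables (F : fieldType) (r : nat).
Notation Psi := (superspace F r).
Implicit Types (w u v : Psi) (A B C S : {set 'I_r}).

Definition ssterm (p : {mpoly F[r]}) A : Psi := [ffun S => p *+ (S == A)].

Definition ssmul w u : Psi :=
  [ffun S : {set 'I_r} => \sum_(A : {set 'I_r} | A \subset S)
     (-1) ^+ inversions A (S :\: A) * (w A * u (S :\: A))].

Lemma inversionsUl A B C : [disjoint A & B] ->
  inversions (A :|: B) C = (inversions A C + inversions B C)%N.
Proof.
move=> dAB; rewrite /inversions -bigU //=.
by apply: eq_bigl => a; rewrite !inE.
Qed.

Lemma inversionsUr A B C : [disjoint B & C] ->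
  inversions A (B :|: C) = (inversions A B + inversions A C)%N.
Proof.
move=> dBC; rewrite /inversions -big_split; apply: eq_bigr => a _ /=.
rewrite -bigU //=; by apply: eq_bigl => b; rewrite !inE.
Qed.

Lemma inversions0l A : inversions set0 A = 0%N.
Proof. by rewrite /inversions big_set0. Qed.

Lemma inversions0r A : inversions A set0 = 0%N.
Proof. by rewrite /inversions big1 // => a _; rewrite big_set0. Qed.

Lemma ssmulA : associative ssmul.
Proof.
move=> w u v; apply/ffunP => S; rewrite !ffunE.
under eq_bigr => B _ do rewrite ffunE !mulr_sumr.
under [RHS]eq_bigr => A _ do rewrite ffunE mulr_suml mulr_sumr.
rewrite [RHS](exchange_big_dep (fun B : {set 'I_r} => B \subset S)) /=; last first.
  by move=> A B sAS sBA; apply: subset_trans sBA sAS.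
apply: eq_bigr => B sBS.
rewrite [RHS](reindex_onto (fun C => B :|: C) (fun A => A :\: B)) /=; last first.
  by move=> A /andP[_ sBA]; rewrite setDE setUIr setUCr setIT; apply/setUidPr.
apply: eq_big => [C | C].
  rewrite subUset sBS subsetUl /= andbT setDUl setDv set0U subsetD.
  congr (_ && _); rewrite setDE; apply/idP/eqP => [dCB | <-].
    by apply/setIidPl; rewrite -disjoints_subset.
  by rewrite disjoints_subset subsetIr.
rewrite subsetD => /andP[sCS dCB].
have -> : (B :|: C) :\: B = C.
  by rewrite setDUl setDv set0U; apply/setDidPl.
have -> : S :\: B :\: C = S :\: (B :|: C) by rewrite setDDl.
set D := S :\: (B :|: C).
have dCD : [disjoint C & D].
  by rewrite disjoint_sym disjoints_subset /D setDE setCU setIA subsetIr.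
have dBC : [disjoint B & C] by rewrite disjoint_sym.
have -> : S :\: B = C :|: D.
  rewrite /D -setDDl -{1}(setID (S :\: B) C); congr (_ :|: _).
  by apply/setIidPr; rewrite subsetD sCS.
rewrite inversionsUr // inversionsUl // !exprD; ring.
Qed.

Lemma ssmul1l : left_id (ssterm 1 set0) ssmul.
Proof.
move=> w; apply/ffunP => S; rewrite ffunE (bigD1 set0) ?sub0set //= big1 ?addr0.
  by rewrite inversions0l setD0 !ffunE eqxx !mul1r.
by move=> A /andP[_ /negPf nA]; rewrite !ffunE nA mulr0n mul0r mulr0.
Qed.

Lemma ssmul1r : right_id (ssterm 1 set0) ssmul.
Proof.
move=> w; apply/ffunP => S; rewrite ffunE (bigD1 S) //= big1 ?addr0.
  by rewrite setDv inversions0r !ffunE eqxx mul1r mulr1.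
move=> A /andP[sAS nAS]; rewrite !ffunE setD_eq0.
case: (boolP (S \subset A)) => [sSA | _]; last by rewrite mulr0n !mulr0.
by rewrite eqEsubset sAS sSA in nAS.
Qed.

Lemma ssmulDl : left_distributive ssmul +%R.
Proof.
move=> w u v; apply/ffunP => S; rewrite !ffunE -big_split.
by apply: eq_bigr => A _; rewrite !ffunE mulrDl mulrDr.
Qed.

Lemma ssmulDr : right_distributive ssmul +%R.
Proof.
move=> w u v; apply/ffunP => S; rewrite !ffunE -big_split.
by apply: eq_bigr => A _; rewrite !ffunE !mulrDr.
Qed.

Lemma ss1_neq0 : ssterm 1 set0 != 0 :> Psi.
Proof.
by apply/eqP => /ffunP/(_ set0)/eqP; rewrite !ffunE eqxx oner_eq0.
Qed.

HB.instance Definition _ := GRing.Zmodule_isNzRing.Build Psi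
  ssmulA ssmul1l ssmul1r ssmulDl ssmulDr ss1_neq0.

Lemma ssscaleAl (c : F) w u : c *: (w * u) = (c *: w) * u.
Proof.
apply/ffunP => S; rewrite !ffunE scaler_sumr; apply: eq_bigr => A _.
by rewrite !ffunE -scalerAl -scalerAr.
Qed.

HB.instance Definition _ := GRing.Lmodule_isLalgebra.Build F Psi ssscaleAl.

Lemma ssscaleAr (c : F) w u : c *: (w * u) = w * (c *: u).
Proof.
apply/ffunP => S; rewrite !ffunE scaler_sumr; apply: eq_bigr => A _.
by rewrite !ffunE -!scalerAr.
Qed.

HB.instance Definition _ := GRing.Lalgebra_isAlgebra.Build F Psi ssscaleAr.

End SuperspaceRing.

Section ExteriorDerivative.
Variables (F : fieldType) (r : nat).
Notation Psi := (superspace F r).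
Implicit Types (w u v : Psi) (A B C S : {set 'I_r}).

Definition sssym (p : {mpoly F[r]}) : Psi := ssterm p set0.
Definition sstheta (k : 'I_r) : Psi := ssterm 1 [set k].

Definition ssderiv (k : 'I_r) w : Psi := [ffun S => (w S)^`M(k)].

Definition ssd w : Psi := \sum_k sstheta k * ssderiv k w.

Definition bihomog (i j : nat) w : Prop :=
  (forall S, w S \is i.-homog) /\ (forall S, #|S| != j -> w S = 0).

Lemma sstermM (p q : {mpoly F[r]}) A B :
  ssterm p A * ssterm q B =
  if [disjoint A & B] then ssterm ((-1) ^+ inversions A B * (p * q)) (A :|: B)
  else 0.
Proof.
apply/ffunP => S; rewrite ffunE.
transitivity (\sum_(A' : {set 'I_r} | (A' \subset S) && (A' == A))
   (-1) ^+ inversions A (S :\: A) * (p * q) *+ (S :\: A == B)).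
  rewrite big_mkcondr; apply: eq_bigr => A' _; rewrite !ffunE.
  case: (eqVneq A' A) => [-> | _]; last by rewrite mulr0n mul0r mulr0.
  by rewrite mulr1n !mulrnAr.
case: (boolP (A \subset S)) => [sAS | nAS]; last first.
  rewrite big1 => [|A' /andP[sA'S /eqP eA]]; last by rewrite -eA sA'S in nAS.
  case: ifP => _; rewrite !ffunE //.
  by case: eqP => [eS|//]; rewrite eS subsetUl in nAS.
rewrite (big_pred1 A) => [|A' /=]; last by case: (eqVneq A' A) => [->|_]; rewrite ?sAS ?andbF ?andbT.
case: ifPn => dAB; rewrite !ffunE.
  have -> : (S :\: A == B) = (S == A :|: B).
    apply/eqP/eqP => [<- | ->]; first by rewrite setDE setUIr setUCr setIT; apply/esym/setUidPr.
    by rewrite setDUl setDv set0U; apply/setDidPl; rewrite disjoint_sym.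
  by case: eqP => [-> | //]; rewrite setDUl setDv set0U (setDidPl _) // disjoint_sym.
case: eqP => [eB | //]; case/negP: dAB.
by rewrite -eB disjoint_sym disjoints_subset setDE subsetIr.
Qed.

Lemma ss_sum w : w = \sum_S ssterm (w S) S.
Proof.
apply/ffunP => S; rewrite sum_ffunE (bigD1 S) //= big1 ?addr0 ?ffunE ?eqxx //.
by move=> A nAS; rewrite ffunE eq_sym (negPf nAS).
Qed.

Lemma ssthetaC w k j : (forall S, #|S| != j -> w S = 0) ->
  sstheta k * w = (-1) ^+ j *: (w * sstheta k).
Proof.
move=> hw; rewrite {1 2}(ss_sum w) mulr_sumr mulr_suml scaler_sumr.
apply: eq_bigr => S _; case: (eqVneq #|S| j) => [<- {hw}| /hw ->]; last first.
  have -> : ssterm 0 S = 0 :> Psi by apply/ffunP => A; rewrite !ffunE mul0rn.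
  by rewrite mulr0 mul0r scaler0.
rewrite /sstheta !sstermM disjoint_sym.
case: ifP => dSk; last by rewrite scaler0.
rewrite setUC; apply/ffunP => A; rewrite !ffunE mul1r mulr1.
case: eqP => _; rewrite ?mulr0n ?scaler0 // !mulr1n.
have -> : #|S| = (inversions [set k] S + inversions S [set k])%N.
  rewrite /inversions big_set1 -sum1_card -big_split; apply: eq_bigr => a aS /=.
  rewrite big_set1; have : a != k.
    by apply: contraTneq dSk => <-; rewrite disjoint_sym disjoints1 aS.
  by rewrite -val_eqE; case: ltngtP.
set a := inversions [set k] S; set b := inversions S [set k].
elim: b => [|b IHb].
  rewrite addn0 expr0 mul1r; elim: a => [|a IHa]; first by rewrite !expr0 scale1r mul1r.
  by rewrite !exprS !mulN1r scaleNr mulNr IHa.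
by rewrite addnS !exprS !mulN1r scaleNr mulNr scalerN opprK.
Qed.

Lemma ssderivM k w u : ssderiv k (w * u) = ssderiv k w * u + w * ssderiv k u.
Proof.
apply/ffunP => S; rewrite !ffunE raddf_sum -big_split; apply: eq_bigr => A _ /=.
rewrite !ffunE -signr_odd; case: odd; rewrite ?expr0 ?mul1r ?mulN1r ?mderivM ?mulrDr //.
by rewrite mderivN mderivM opprD.
Qed.

Lemma ssd_leibniz j w u : (forall S, #|S| != j -> w S = 0) ->
  ssd (w * u) = ssd w * u + (-1) ^+ j *: (w * ssd u).
Proof.
move=> hw; rewrite /ssd mulr_suml mulr_sumr scaler_sumr -big_split.
apply: eq_bigr => k _ /=; rewrite ssderivM mulrDr !mulrA; congr (_ + _).
by rewrite (ssthetaC _ hw) -scalerAl.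
Qed.

Lemma ssd_linear : linear ssd.
Proof.
move=> c w u; rewrite /ssd scaler_sumr -big_split; apply: eq_bigr => k _ /=.
rewrite scalerAr -mulrDr; congr (_ * _).
by apply/ffunP => S; rewrite !ffunE linearP.
Qed.

Lemma ssd_var k : ssd (sssym 'X_k) = sstheta k.
Proof.
rewrite /ssd (bigD1 k) //= big1 ?addr0 => [|l nlk].
  rewrite -[RHS]mulr1; congr (_ * _); apply/ffunP => S; rewrite !ffunE.
  case: eqP => _; rewrite ?mulr0n ?linear0 // !mulr1n mderivX mnm1E eqxx scale1r.
  by rewrite -{1}[U_(k)%MM]add0m addmK mpolyX0.
rewrite -[RHS](mulr0 (sstheta l)); congr (_ * _); apply/ffunP => S; rewrite !ffunE.
by case: eqP => _; rewrite ?mulr0n ?linear0 // mulr1n mderivX mnm1E eq_sym (negPf nlk) scale0r.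
Qed.

Lemma ssd_theta k : ssd (sstheta k) = 0.
Proof.
rewrite /ssd big1 // => l _; rewrite -[RHS](mulr0 (sstheta l)); congr (_ * _).
by apply/ffunP => S; rewrite !ffunE; case: eqP => _; rewrite ?mulr0n ?linear0 // mulr1n -mpolyC1 mderivC.
Qed.

Lemma sssymM p q : sssym (p * q) = sssym p * sssym q.
Proof. by rewrite /sssym sstermM disjoints_subset sub0set inversions0l setU0 !mul1r. Qed.

End ExteriorDerivative.

Definition is_ideal (A : pzRingType) (I : A -> Prop) : Prop :=
  [/\ I 0, forall a b, I a -> I b -> I (a + b),
      forall x a, I a -> I (x * a) & forall x a, I a -> I (a * x)].

Definition ideal_gen (A : pzRingType) (G : A -> Prop) (a : A) : Prop :=
  forall I : A -> Prop, is_ideal I -> (forall g, G g -> I g) -> I a.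

Definition diff_closure (F : fieldType) (r : nat) (J : {mpoly F[r]} -> Prop)
    (w : superspace F r) : Prop :=
  forall I : superspace F r -> Prop, is_ideal I ->
    (forall p, J p -> I (sssym p)) -> (forall u, I u -> I (ssd u)) -> I w.

(* [V] and [I] are linear subspaces and V / (V :&: I), that is the image of V
   modulo I, has dimension [m]: the [b k] represent a basis of it. *)
Definition dim_mod (F : fieldType) (M : lmodType F) (V I : M -> Prop) (m : nat) :
    Prop :=
  exists b : 'I_m -> M,
    [/\ forall k, V (b k),
        forall c : 'I_m -> F, I (\sum_k c k *: b k) -> forall k, c k = 0 &
        forall w, V w -> exists c : 'I_m -> F, I (w - \sum_k c k *: b k)].

Definition Qqt : fieldType := {fraction {poly {poly rat}}}.
Definition qvar : Qqt := tofrac ('X%:P).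
Definition tvar : Qqt := tofrac 'X.

(* [P i j m]: the component of bidegree (i, j) has dimension m.  Only finitely
   many components may be nonzero, so that their generating function lies in
   Q(q, t). *)
Definition has_Hilb (P : nat -> nat -> nat -> Prop) (H : Qqt) : Prop :=
  exists (h : nat -> nat -> nat) (N : nat),
    [/\ forall i j, P i j (h i j),
        forall i j, (N <= i)%N || (N <= j)%N -> h i j = 0%N &
        H = \sum_(i < N) \sum_(j < N) (h i j)%:R * qvar ^+ i * tvar ^+ j].

Section Arrangement.
Variables (F : fieldType) (L : vectType F) (n : nat).
Variable ell : 'I_n -> 'Hom(L, F^o).

Definition hyp (i : 'I_n) : {vspace L} := lker (ell i).

Definition rk (A : {set 'I_n}) : nat := \dim <<[seq ell i | i in A]>>%VS.

(* The truncated subtractions are exact: rk A <= \dim {:L} and rk A <= #|A|. *)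
Definition tutte (K : fieldType) (x y : K) : K :=
  \sum_(A : {set 'I_n})
     (x - 1) ^+ (\dim {:L} - rk A) * (y - 1) ^+ (#|A| - rk A).

Definition rho (v : L) : nat := #|[set i | v \notin hyp i]|.

(* Sym L (x) /\ L, the k-th vector of the basis [vbasis {:L}] of L being
   identified with x_k in Sym L and with theta_k in /\ L. *)
Definition Psi := superspace F (\dim {:L}).

Definition symv (v : L) : {mpoly F[\dim {:L}]} :=
  \sum_k coord (vbasis {:L}) k v *: 'X_k.
Definition extv (v : L) : Psi :=
  \sum_k coord (vbasis {:L}) k v *: sstheta F k.

Lemma ssd_symv v : ssd (sssym (symv v)) = extv v.
Proof.
have -> : sssym (symv v) = \sum_k coord (vbasis {:L}) k v *: sssym 'X_k.
  apply/ffunP => S; rewrite /symv sum_ffunE ffunE.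
  case: (eqVneq S set0) => [->|/negPf nS].
    by rewrite mulr1n; apply: eq_bigr => k _; rewrite !ffunE eqxx mulr1n.
  by rewrite mulr0n big1 // => k _; rewrite !ffunE nS mulr0n scaler0.
pose f : {linear Psi -> Psi} := HB.pack (@ssd F (\dim {:L}))
  (GRing.isLinear.Build _ _ _ _ _ (@ssd_linear F (\dim {:L}))).
rewrite -[LHS]/(f _) linear_sum; apply: eq_bigr => k _.
by rewrite linearZ /= ssd_var.
Qed.

Definition power_ideal : {mpoly F[\dim {:L}]} -> Prop :=
  ideal_gen (fun p => exists2 v : L, v != 0 & p = symv v ^+ rho v).

Definition Zideal : Psi -> Prop := diff_closure power_ideal.

Definition Zdim (i j : nat) : nat -> Prop :=
  dim_mod (@bihomog F (\dim {:L}) i j) Zideal.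

End Arrangement.

(* Main.v *)
(* Both sides satisfy the deletion-restriction recursion. Inside the fixed ring
   Sym L (x) /\L, let R_W = Sym W (x) /\L for a subspace W of L and let J(W, A)
   be the ideal of R_W generated by v ^ rho_A(v) and d (v ^ rho_A(v)), v in W.
   If f in A is neither a loop nor a coloop on W, contracting the commutative
   variables with f gives a sequence
     0 -> R_(W n H_f) / J(W n H_f, A \ f) -> R_W / J(W, A) -> R_W / J(W, A \ f) -> 0,
   of which everything but the injectivity on the left is integration along a
   vector. A coloop f with direction u is removed by restricting to H_f and
   killing theta_u.

   The injectivity is proved for a whole flat at once: if W = W0 n H_S with S in
   A, then J(W0, A) n R_W is J(W, A) together with the theta_u of the coloop
   directions u. Take f in A not vanishing on W, and not a coloop there. For T a
   set of elements in series with f, the supercommutator of d with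
   iota_f iota_T maps J(W0, A) into J(W0, A \ f), and on R_W it equals
   iota_T d_f, where d_f is the contraction of commutative variables. So by
   induction on A all iota_T d_f x lie in J(W, A \ f) up to the directions of the
   new coloops of A \ f, and varying T eliminates these. Integrating d_f x
   reduces to W n H_f. *)

Require Import Defs.
From HB Require Import structures.
From mathcomp Require Import all_boot all_order all_algebra.
From mathcomp Require Import reals complex.
From mathcomp Require Import mpoly.
From mathcomp Require Import ring.

Set Implicit Arguments.
Unset Strict Implicit.
Unset Printing Implicit Defensive.

Import Order.TTheory GRing.Theory Num.Theory.
Local Open Scope ring_scope.
Local Open Scope complex_scope.

(** * Operators in coordinates *)

(** The difficulty comes from keeping the exterior factor whole while the symmetric factor shrinks.
    A vector [u] of [W0] with [rho] equal to 1 puts both u and theta_u = du in the ideal. If [u] is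
    outside [W], theta_u still lies in the ring over [W], but vectors of [W] need not produce it.
    Deleting [f] creates such vectors: an element [e] in series with [f] becomes a coloop.
    Contraction with [e] detects the new theta_u, yet it does not preserve the ideal over [W0],
    because from v ^ (rho - 1) theta_v it produces the term (e v) v ^ (rho - 1), one power short.
    The commutator with d also costs one power of v, but the deletion of [f] pays for it. If f v is
    nonzero, rho drops by one. If f v = 0 and e v is nonzero, v is shifted along u, which lies in
    the smaller ideal, until e vanishes on it. On the Tutte side every removed coloop costs one
    exterior generator, hence one factor 1 + t, which is the effect of x = 1 / (1 + t). *)

Section CoordinateOperators.
Variables (F : fieldType) (r : nat).
Notation Psi := (superspace F r).
Implicit Types (x y : Psi) (p q : {mpoly F[r]}) (S : {set 'I_r}).

Lemma ssDE x y S : (x + y) S = x S + y S. Proof. by rewrite ffunE. Qed.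

Lemma ssNE x S : (- x) S = - x S. Proof. by rewrite ffunE. Qed.

Lemma ssZE (a : F) x S : (a *: x) S = a *: x S. Proof. by rewrite ffunE. Qed.

Lemma sssymE p y S : (sssym p * y) S = p * y S.
Proof.
rewrite ffunE (bigD1 set0) ?sub0set //= big1 ?addr0 => [|A /andP[_ nA]].
  by rewrite inversions0l setD0 !ffunE eqxx !mul1r.
by rewrite !ffunE (negPf nA) mulr0n mul0r mulr0.
Qed.

Lemma mul_sssymE p y S : (y * sssym p) S = p * y S.
Proof.
rewrite ffunE (bigD1 S) //= big1 ?addr0 => [|A /andP[sAS nA]].
  by rewrite setDv inversions0r !ffunE eqxx mul1r mulrC.
rewrite !ffunE setD_eq0 [S \subset A](_ : _ = false) ?mulr0n ?mulr0 //.
by apply: contraNF nA => sSA; rewrite eqEsubset sAS.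
Qed.

Lemma sssymC p y : sssym p * y = y * sssym p.
Proof. by apply/ffunP => S; rewrite sssymE mul_sssymE. Qed.

Lemma ssthetaE k y S : (sstheta F k * y) S =
  if k \in S then (-1) ^+ inversions [set k] (S :\ k) * y (S :\ k) else 0.
Proof.
rewrite ffunE; case: ifPn => kS.
  rewrite (bigD1 [set k]) ?sub1set //= big1 ?addr0 => [|A /andP[_ nA]].
    by rewrite !ffunE eqxx mul1r.
  by rewrite !ffunE (negPf nA) mulr0n mul0r mulr0.
rewrite big1 // => A sAS; rewrite !ffunE; case: eqP => [eA|_].
  by rewrite eA sub1set (negPf kS) in sAS.
by rewrite mulr0n mul0r mulr0.
Qed.

(** Left contraction against theta_k. The sign is the one in theta_k theta_S = +- theta_(k |: S), so
    that left multiplication by theta_k is undone on sets missing [k]. *)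
Definition ssint (k : 'I_r) x : Psi :=
  [ffun S : {set 'I_r} => if k \in S then 0 else (-1) ^+ inversions [set k] S * x (k |: S)].

Lemma ssderiv_is_linear k : linear (@ssderiv F r k).
Proof. by move=> a x y; apply/ffunP => S; rewrite !ffunE linearP. Qed.
HB.instance Definition _ k :=
  GRing.isLinear.Build F Psi Psi _ (@ssderiv F r k) (ssderiv_is_linear k).

Lemma ssint_is_linear k : linear (ssint k).
Proof.
move=> a x y; apply/ffunP => S; rewrite !ffunE; case: ifP => _.
  by rewrite scaler0 addr0.
by rewrite mulrDr -scalerAr.
Qed.
HB.instance Definition _ k :=
  GRing.isLinear.Build F Psi Psi _ (ssint k) (ssint_is_linear k).

Lemma ssderivC k l x : ssderiv k (ssderiv l x) = ssderiv l (ssderiv k x).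
Proof. by apply/ffunP => S; rewrite !ffunE mderiv_comm. Qed.

Lemma mderivMsign k n p : ((-1) ^+ n * p)^`M(k) = (-1) ^+ n * p^`M(k).
Proof.
by rewrite -signr_odd; case: odd; rewrite ?mul1r ?expr1 ?mulN1r ?linearN.
Qed.

Lemma ssderiv_ssint k l x : ssderiv k (ssint l x) = ssint l (ssderiv k x).
Proof.
apply/ffunP => S; rewrite !ffunE; case: ifP => _; first by rewrite linear0.
by rewrite mderivMsign.
Qed.

Lemma ssderiv_var k l x :
  ssderiv k (sssym 'X_l * x) = (k == l)%:R *: x + sssym 'X_l * ssderiv k x.
Proof.
apply/ffunP => S; rewrite ssDE ssZE ffunE !sssymE mderivM ffunE.
congr (_ + _); rewrite mderivX mnm1E eq_sym; case: eqP => [->|_]; last first.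
  by rewrite !scale0r mul0r.
by rewrite -{1}[U_(l)%MM]add0m addmK mpolyX0 !scale1r mul1r.
Qed.

Lemma ssderiv_theta k l x :
  ssderiv k (sstheta F l * x) = sstheta F l * ssderiv k x.
Proof.
apply/ffunP => S; rewrite ffunE !ssthetaE; case: ifP => _; last by rewrite linear0.
by rewrite mderivMsign !ffunE.
Qed.

Lemma ssint_sssym k p x : ssint k (sssym p * x) = sssym p * ssint k x.
Proof.
apply/ffunP => S; rewrite ffunE !sssymE ffunE; case: ifP => _; first by rewrite mulr0.
by rewrite mulrCA.
Qed.

Lemma inversions1U k l S : l \notin S ->
  inversions [set k] (l |: S) = ((l < k) + inversions [set k] S)%N.
Proof. by move=> lS; rewrite /inversions !big_set1 big_setU1. Qed.

Lemma sign_mul_sqr n p : (-1) ^+ n * ((-1) ^+ n * p) = p.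
Proof. by rewrite mulrA -exprMn mulrNN mul1r expr1n mul1r. Qed.

Lemma ssint_theta k l x :
  ssint k (sstheta F l * x) = (k == l)%:R *: x - sstheta F l * ssint k x.
Proof.
apply/ffunP => S.
rewrite ssDE ssNE ssZE ffunE !ssthetaE ffunE in_setU1.
case: (eqVneq k l) => [<-{l}|nkl].
  rewrite scale1r !inE eqxx /=.
  case: ifPn => kS; first by rewrite setD1K // sign_mul_sqr subrr.
  by rewrite setU1K // sign_mul_sqr subr0.
  rewrite scale0r sub0r !inE nkl /=.
case: (boolP (k \in S)) => kS; first by case: ifP; rewrite ?mulr0 oppr0.
case: (boolP (l \in S)) => lS; last by rewrite mulr0 oppr0.
have -> : (k |: S) :\ l = k |: (S :\ l).
  by apply/setP => m; rewrite !inE; case: (eqVneq m k) => [->|]; rewrite ?nkl ?orbF ?andbT.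
have -> : inversions [set k] S = ((l < k) + inversions [set k] (S :\ l))%N.
  by rewrite -inversions1U ?setD1K // !inE eqxx.
rewrite inversions1U ?inE ?nkl //.
(* Exactly one of the two orders holds, so the two reorderings differ by one transposition; this is
   the minus sign. *)
rewrite !exprD !mulrA; have : (l < k)%N (+) (k < l)%N.
  by move: nkl; rewrite -val_eqE; case: ltngtP.
move: ((-1) ^+ inversions [set k] _) ((-1) ^+ inversions [set l] _) (x _) => P Q X.
by case: (l < k)%N; case: (k < l)%N => //= _; rewrite ?expr0 ?expr1; ring.
Qed.

Lemma sstheta_anti (k l : 'I_r) : sstheta F k * sstheta F l = - (sstheta F l * sstheta F k).
Proof.
rewrite (@ssthetaC _ _ _ _ 1) ?expr1 ?scaleN1r // => S nS.
by rewrite ffunE; case: (eqVneq S [set l]) nS => [->|_ _]; rewrite ?cards1 ?mulr0n.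
Qed.

Lemma sign_scale n p : (-1) ^+ n * p = (-1) ^+ n *: p.
Proof.
rewrite -signr_odd -[in RHS]signr_odd.
by case: odd; rewrite ?expr0 ?expr1 ?mul1r ?mulN1r ?scale1r ?scaleN1r.
Qed.

(** The grading involution; it moves an inhomogeneous element past theta_k. *)
Definition ssparity x : Psi := [ffun S : {set 'I_r} => (-1) ^+ #|S| * x S].

Lemma mul_sstheta k x : x * sstheta F k = sstheta F k * ssparity x.
Proof.
rewrite {1}(ss_sum x) [ssparity x]ss_sum mulr_suml mulr_sumr.
apply: eq_bigr => S _.
have -> : ssterm (ssparity x S) S = (-1) ^+ #|S| *: ssterm (x S) S :> Psi.
  by apply/ffunP => A; rewrite !ffunE sign_scale scalerMnr.
rewrite -scalerAr (@ssthetaC _ _ _ _ #|S|) ?scalerA.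
  by rewrite -expr2 sqrr_sign scale1r.
by move=> A; rewrite ffunE; case: (eqVneq A S) => [->|]; rewrite ?eqxx.
Qed.

Lemma mcoeff_pihomog d p m :
  (pihomog mdeg d p)@_m = if mdeg m == d then p@_m else 0.
Proof.
rewrite {2}[p]mpolyE pihomogE !raddf_sum /= big_mkcond /=.
have [dm|ndm] := ifPn; last first.
  apply: big1 => m' _; case: ifP => // dm'; rewrite mcoeffZ mcoeffX.
  by case: (eqVneq m' m) dm' ndm => [->->|]; rewrite ?mulr0.
apply: eq_bigr => m' _; case: ifPn => // dm'; rewrite mcoeffZ mcoeffX.
by case: (eqVneq m' m) dm' dm => [-> /negPf->|]; rewrite ?mulr0.
Qed.

Lemma subU1K (m : 'X_{1..r}) k : m k != 0%N -> (m - U_(k) + U_(k))%MM = m.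
Proof.
move=> mk; rewrite submK //; apply/mnm_lepP => l.
by rewrite mnm1E; case: eqP => [<-|]; rewrite ?lt0n.
Qed.

Lemma mcoeff_varM k p m :
  ('X_k * p)@_m = if m k == 0%N then 0 else p@_(m - U_(k)).
Proof.
case: ifPn => mk.
  rewrite mulrC mcoeffM big1 // => -[k1 k2] /eqP em.
  rewrite mcoeffX; case: (eqVneq U_(k)%MM (k2 : 'X_{1..r})) => [eU|_]; rewrite ?mulr0 //.
  have em_k : m k = (k1 + k2)%MM k by rewrite -em.
  by move/eqP: mk; rewrite em_k mnmDE -eU mnm1E eqxx addn1.
by rewrite -{1}(subU1K mk) mulrC addmC mcoeffMX.
Qed.

Lemma mdegBU (m : 'X_{1..r}) k : m k != 0%N -> mdeg m = (mdeg (m - U_(k))).+1.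
Proof.
move=> mk; by rewrite -{1}(subU1K mk) mdegD mdeg1 addn1.
Qed.

Lemma pihomog_var d k p :
  pihomog mdeg d.+1 ('X_k * p) = 'X_k * pihomog mdeg d p.
Proof.
apply/mpolyP => m; rewrite mcoeff_pihomog !mcoeff_varM mcoeff_pihomog.
case: (boolP (m k == 0%N)) => mk; first by case: ifP.
by rewrite (mdegBU mk) eqSS.
Qed.

Lemma pihomog0_var k p : pihomog mdeg 0 ('X_k * p) = 0.
Proof.
apply/mpolyP => m; rewrite mcoeff_pihomog mcoeff_varM mcoeff0.
by case: (boolP (m k == 0%N)) => mk; [case: ifP | rewrite (mdegBU mk)].
Qed.

Lemma pihomog_deriv d k p :
  pihomog mdeg d p^`M(k) = (pihomog mdeg d.+1 p)^`M(k).
Proof.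
apply/mpolyP => m; rewrite mcoeff_pihomog !mcoeff_mderiv mcoeff_pihomog.
by rewrite mdegD mdeg1 addn1 eqSS; case: ifP; rewrite ?mul0rn.
Qed.

Lemma pihomog_sign d n p :
  pihomog mdeg d ((-1) ^+ n * p) = (-1) ^+ n * pihomog mdeg d p.
Proof.
by rewrite -signr_odd; case: odd; rewrite ?mul1r ?expr1 ?mulN1r ?linearN.
Qed.

Definition ssproj i j x : Psi :=
  [ffun S : {set 'I_r} => if #|S| == j then pihomog mdeg i (x S) else 0].

Lemma ssproj_is_linear i j : linear (ssproj i j).
Proof.
move=> a x y; apply/ffunP => S; rewrite !ffunE.
by case: ifP => _; rewrite ?linearP // scaler0 addr0.
Qed.
HB.instance Definition _ i j :=
  GRing.isLinear.Build F Psi Psi _ (ssproj i j) (ssproj_is_linear i j).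

Lemma bihomog_ssproj i j x : bihomog i j (ssproj i j x).
Proof.
split=> S; first by rewrite ffunE; case: ifP => _; rewrite ?pihomogP ?dhomog0.
by rewrite ffunE => /negPf->.
Qed.

Lemma ssproj_id i j x : bihomog i j x -> ssproj i j x = x.
Proof.
move=> [hx zx]; apply/ffunP => S; rewrite ffunE.
by case: eqP => [_|/eqP/zx->//]; rewrite pihomog_dE.
Qed.

Lemma ssproj_deriv i j k x : ssproj i j (ssderiv k x) = ssderiv k (ssproj i.+1 j x).
Proof.
by apply/ffunP => S; rewrite !ffunE; case: ifP => _; rewrite ?pihomog_deriv ?linear0.
Qed.

Lemma ssproj_var i j k x :
  ssproj i.+1 j (sssym 'X_k * x) = sssym 'X_k * ssproj i j x.
Proof.
apply/ffunP => S; rewrite ffunE !sssymE ffunE.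
by case: ifP => _; rewrite ?pihomog_var ?mulr0.
Qed.

Lemma ssproj0_var j k x : ssproj 0 j (sssym 'X_k * x) = 0.
Proof.
by apply/ffunP => S; rewrite ffunE sssymE pihomog0_var if_same ffunE.
Qed.

Lemma ssproj_theta i j k x :
  ssproj i j.+1 (sstheta F k * x) = sstheta F k * ssproj i j x.
Proof.
apply/ffunP => S; rewrite ffunE !ssthetaE ffunE.
case: (boolP (k \in S)) => kS; last by rewrite linear0 if_same.
rewrite (cardsD1 k) kS eqSS; case: ifP => _; last by rewrite mulr0.
by rewrite pihomog_sign.
Qed.

Lemma ssproj0_theta i k x : ssproj i 0 (sstheta F k * x) = 0.
Proof.
apply/ffunP => S; rewrite ffunE [RHS]ffunE ssthetaE; case: (boolP (k \in S)) => kS.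
  by rewrite (cardsD1 k) kS.
by rewrite linear0 if_same.
Qed.

Definition sseval0 x : Psi := [ffun S : {set 'I_r} => ((x S)@_0)%:MP].

Lemma sseval0_is_linear : linear sseval0.
Proof.
move=> a x y; apply/ffunP => S; rewrite !ffunE mcoeffD mcoeffZ.
by rewrite mpolyCD mpolyCM mul_mpolyC.
Qed.
HB.instance Definition _ :=
  GRing.isLinear.Build F Psi Psi _ sseval0 sseval0_is_linear.

Lemma sseval0_var k x : sseval0 (sssym 'X_k * x) = 0.
Proof.
by apply/ffunP => S; rewrite ffunE sssymE mcoeff_varM mnm0E eqxx mpolyC0 ffunE.
Qed.

Lemma sseval0_theta k x : sseval0 (sstheta F k * x) = sstheta F k * sseval0 x.
Proof.
apply/ffunP => S; rewrite ffunE !ssthetaE ffunE.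
case: ifP => _; last by rewrite raddf0 mpolyC0.
by rewrite -signr_odd; case: odd; rewrite ?mul1r ?expr1 ?mulN1r // mcoeffN mpolyCN.
Qed.

(** A strict bound on the commutative degree: bound 0 forces x = 0 and each derivation [dl l] lowers
    the bound by one. It is the measure behind local nilpotency. *)
Definition deg_lt d x := forall S m, (d <= mdeg m)%N -> (x S)@_m = 0.

Lemma deg_lt_exists x : exists d, deg_lt d x.
Proof.
exists (\max_S msize (x S)) => S m le_m; apply: memN_msupp_eq0.
apply/negP => /msize_mdeg_lt; rewrite ltnNge => /negP; apply.
by apply: leq_trans le_m; apply: leq_bigmax.
Qed.

Lemma deg_lt0 x : deg_lt 0 x -> x = 0.
Proof.
by move=> x0; apply/ffunP => S; apply/mpolyP => m; rewrite x0 // ffunE mcoeff0.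
Qed.

Lemma deg_lt_deriv d k x : deg_lt d.+1 x -> deg_lt d (ssderiv k x).
Proof.
move=> xd S m le_m; rewrite ffunE mcoeff_mderiv xd ?mul0rn //.
by rewrite mdegD mdeg1 addn1.
Qed.

Hypothesis char0 : forall n, n.+1%:R != 0 :> F.

(** The coefficient of a monomial m with m k nonzero reappears in the k-th derivative multiplied by
    m k, which is invertible in characteristic 0. *)
Lemma sseval0_id x : (forall k, ssderiv k x = 0) -> sseval0 x = x.
Proof.
move=> dx; apply/ffunP => S; rewrite ffunE; apply/mpolyP => m.
rewrite mcoeffC; case: (eqVneq m 0%MM) => [->|nm]; first by rewrite mulr1.
have [k mk] : exists k, m k != 0%N.
  apply/existsP; apply: contraNT nm => /existsPn nm; apply/eqP/mnmP => k.
  by rewrite mnm0E; apply/eqP; rewrite -[_ == _]negbK nm.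
rewrite mulr0.
move/ffunP/(_ S): (dx k); rewrite !ffunE => /mpolyP/(_ (m - U_(k))%MM)/eqP.
rewrite mcoeff_mderiv subU1K // mcoeff0.
by rewrite -mulr_natr mulf_eq0 (negPf (char0 _)) orbF => /eqP.
Qed.

End CoordinateOperators.

(** * Coordinate-free operators *)

Section InvariantOperators.
Variables (F : fieldType) (L : vectType F).
Notation Psi := (superspace F (\dim {:L})).
Notation form := 'Hom(L, F^o).
Implicit Types (x y z : Psi) (u v w : L) (l f e : form).

(* The vector v as an element of Sym L, resp. of /\^1 L. *)
Definition sv v : Psi := sssym (symv v).
Definition tv v : Psi := extv v.

(* The derivation v |-> l v, theta_v |-> 0 and the antiderivation v |-> 0,
   theta_v |-> l v. *)
Definition dl l x : Psi := \sum_(k < \dim {:L}) l (vbasis {:L})`_k *: ssderiv k x.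
Definition il l x : Psi := \sum_(k < \dim {:L}) l (vbasis {:L})`_k *: ssint k x.

Lemma dl_is_linear l : linear (dl l).
Proof.
move=> a x y; rewrite /dl scaler_sumr -big_split; apply: eq_bigr => k _ /=.
by rewrite linearP scalerDr !scalerA mulrC.
Qed.
HB.instance Definition _ l :=
  GRing.isLinear.Build F Psi Psi _ (dl l) (dl_is_linear l).

Lemma il_is_linear l : linear (il l).
Proof.
move=> a x y; rewrite /il scaler_sumr -big_split; apply: eq_bigr => k _ /=.
by rewrite linearP scalerDr !scalerA mulrC.
Qed.
HB.instance Definition _ l :=
  GRing.isLinear.Build F Psi Psi _ (il l) (il_is_linear l).

Lemma svE v : sv v = \sum_k coord (vbasis {:L}) k v *: sssym 'X_k.
Proof.
apply/ffunP => S; rewrite /sv /symv sum_ffunE ffunE.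
case: (eqVneq S set0) => [->|/negPf nS].
  by rewrite mulr1n; apply: eq_bigr => k _; rewrite !ffunE eqxx mulr1n.
by rewrite mulr0n big1 // => k _; rewrite !ffunE nS mulr0n scaler0.
Qed.

Lemma svM v x : sv v * x = \sum_k coord (vbasis {:L}) k v *: (sssym 'X_k * x).
Proof. by rewrite svE mulr_suml; apply: eq_bigr => k _; rewrite -scalerAl. Qed.

Lemma tvM v x : tv v * x = \sum_k coord (vbasis {:L}) k v *: (sstheta F k * x).
Proof. by rewrite mulr_suml; apply: eq_bigr => k _; rewrite -scalerAl. Qed.

Lemma sv_is_linear : linear sv.
Proof.
move=> a u v; rewrite !svE scaler_sumr -big_split; apply: eq_bigr => k _ /=.
by rewrite linearP scalerDl scalerA.
Qed.
HB.instance Definition _ := GRing.isLinear.Build F L Psi _ sv sv_is_linear.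

Lemma tv_is_linear : linear tv.
Proof.
move=> a u v; rewrite /tv /extv scaler_sumr -big_split; apply: eq_bigr => k _ /=.
by rewrite linearP scalerDl scalerA.
Qed.
HB.instance Definition _ := GRing.isLinear.Build F L Psi _ tv tv_is_linear.

Lemma fun_coord l v :
  l v = \sum_(k < \dim {:L}) coord (vbasis {:L}) k v * l (vbasis {:L})`_k.
Proof.
rewrite {1}(coord_vbasis (memvf v)) linear_sum; apply: eq_bigr => k _.
by rewrite linearZ.
Qed.

Lemma svC v x : sv v * x = x * sv v.
Proof. exact: sssymC. Qed.

Lemma svCA v x y : x * (sv v * y) = sv v * (x * y).
Proof. by rewrite !mulrA svC. Qed.

Lemma svXC v n x : sv v ^+ n * x = x * sv v ^+ n.
Proof. by apply/esym/commrX; rewrite /GRing.comm svC. Qed.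

Lemma tv_anti u v : tv u * tv v = - (tv v * tv u).
Proof.
rewrite !tvM -sumrN.
transitivity (\sum_k \sum_m (coord (vbasis {:L}) k u * coord (vbasis {:L}) m v)
    *: (sstheta F k * sstheta F m)).
  apply: eq_bigr => k _; rewrite mulr_sumr scaler_sumr.
  by apply: eq_bigr => m _; rewrite -scalerAr scalerA.
rewrite exchange_big; apply: eq_bigr => m _; rewrite mulr_sumr scaler_sumr -sumrN.
apply: eq_bigr => k _ /=; rewrite -scalerAr scalerA sstheta_anti scalerN.
by rewrite mulrC.
Qed.

Lemma tvCA u v x : tv u * (tv v * x) = - (tv v * (tv u * x)).
Proof. by rewrite !mulrA tv_anti mulNr. Qed.

Lemma mul_tv v x : x * tv v = tv v * ssparity x.
Proof.
rewrite tvM mulr_sumr; apply: eq_bigr => k _.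
by rewrite -scalerAr mul_sstheta.
Qed.

Lemma dl_sv l v x : dl l (sv v * x) = l v *: x + sv v * dl l x.
Proof.
rewrite svM linear_sum /= fun_coord scaler_suml svM -big_split.
apply: eq_bigr => k _ /=; rewrite linearZ /= -scalerA -scalerDr; congr (_ *: _).
rewrite /dl mulr_sumr.
rewrite -[l _ *: x](_ : \sum_(i < \dim {:L})
  (l (vbasis {:L})`_i * (i == k)%:R) *: x = _); last first.
  rewrite (bigD1 k) //= eqxx mulr1 big1 ?addr0 // => i /negPf->.
  by rewrite mulr0 scale0r.
rewrite -big_split; apply: eq_bigr => i _ /=.
by rewrite ssderiv_var scalerDr scalerA -scalerAr.
Qed.

Lemma dl_tv l v x : dl l (tv v * x) = tv v * dl l x.
Proof.
rewrite tvM linear_sum tvM; apply: eq_bigr => k _.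
rewrite linearZ /=; congr (_ *: _); rewrite /dl mulr_sumr; apply: eq_bigr => i _.
by rewrite ssderiv_theta -scalerAr.
Qed.

Lemma il_sv l v x : il l (sv v * x) = sv v * il l x.
Proof.
rewrite svM linear_sum svM; apply: eq_bigr => k _.
rewrite linearZ /=; congr (_ *: _); rewrite /il mulr_sumr; apply: eq_bigr => i _.
by rewrite ssint_sssym -scalerAr.
Qed.

Lemma il_tv l v x : il l (tv v * x) = l v *: x - tv v * il l x.
Proof.
rewrite tvM linear_sum /= fun_coord scaler_suml tvM -sumrN -big_split.
apply: eq_bigr => k _ /=; rewrite linearZ /= -scalerA -scalerN -scalerDr; congr (_ *: _).
rewrite /il mulr_sumr -sumrN.
rewrite -[l _ *: x](_ : \sum_(i < \dim {:L})
  (l (vbasis {:L})`_i * (i == k)%:R) *: x = _); last first.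
  rewrite (bigD1 k) //= eqxx mulr1 big1 ?addr0 // => i /negPf->.
  by rewrite mulr0 scale0r.
rewrite -big_split; apply: eq_bigr => i _ /=.
by rewrite ssint_theta scalerDr scalerA -scalerAr scalerN.
Qed.

Lemma ssderiv_dl k f x : ssderiv k (dl f x) = dl f (ssderiv k x).
Proof.
rewrite /dl linear_sum; apply: eq_bigr => m _.
by rewrite linearZ /= ssderivC.
Qed.

Lemma dl_dl l f x : dl l (dl f x) = dl f (dl l x).
Proof.
rewrite [dl l x in RHS]/dl [RHS]linear_sum; apply: eq_bigr => k _.
by rewrite [RHS]linearZ /= ssderiv_dl.
Qed.

Lemma ssderiv_il k f x : ssderiv k (il f x) = il f (ssderiv k x).
Proof.
rewrite /il linear_sum; apply: eq_bigr => m _.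
by rewrite linearZ /= ssderiv_ssint.
Qed.

Lemma dl_il l f x : dl l (il f x) = il f (dl l x).
Proof.
rewrite [dl l x in RHS]/dl [RHS]linear_sum; apply: eq_bigr => k _.
by rewrite [RHS]linearZ /= ssderiv_il.
Qed.

Lemma dl_linear_form a l f x : dl (a *: l + f) x = a *: dl l x + dl f x.
Proof.
rewrite /dl scaler_sumr -big_split; apply: eq_bigr => k _ /=.
by rewrite lfunE /= lfunE /= scalerDl scalerA.
Qed.

Lemma ssproj_sv i j v x : ssproj i.+1 j (sv v * x) = sv v * ssproj i j x.
Proof.
rewrite !svM linear_sum; apply: eq_bigr => k _.
by rewrite linearZ /= ssproj_var.
Qed.

Lemma ssproj0_sv j v x : ssproj 0 j (sv v * x) = 0.
Proof.
by rewrite svM linear_sum big1 // => k _; rewrite linearZ /= ssproj0_var scaler0.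
Qed.

Lemma ssproj_svX i j n v x :
  ssproj i j (sv v ^+ n * x) = if (n <= i)%N then sv v ^+ n * ssproj (i - n) j x else 0.
Proof.
elim: n i => [|n IHn] i; first by rewrite !mul1r subn0.
rewrite exprS -mulrA; case: i => [|i]; first by rewrite ssproj0_sv.
by rewrite ssproj_sv IHn ltnS subSS; case: ifP; rewrite ?mulr0 ?mulrA.
Qed.

Lemma ssproj_tv i j v x : ssproj i j.+1 (tv v * x) = tv v * ssproj i j x.
Proof.
rewrite !tvM linear_sum; apply: eq_bigr => k _.
by rewrite linearZ /= ssproj_theta.
Qed.

Lemma ssproj0_tv i v x : ssproj i 0 (tv v * x) = 0.
Proof.
by rewrite tvM linear_sum big1 // => k _; rewrite linearZ /= ssproj0_theta scaler0.
Qed.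

Lemma ssproj_dl i j l x : ssproj i j (dl l x) = dl l (ssproj i.+1 j x).
Proof.
by rewrite linear_sum; apply: eq_bigr => k _; rewrite linearZ /= ssproj_deriv.
Qed.

Lemma sseval0_sv v x : sseval0 (sv v * x) = 0.
Proof.
by rewrite svM linear_sum big1 // => k _; rewrite linearZ /= sseval0_var scaler0.
Qed.

Lemma sseval0_tv v x : sseval0 (tv v * x) = tv v * sseval0 x.
Proof.
rewrite !tvM linear_sum; apply: eq_bigr => k _.
by rewrite linearZ /= sseval0_theta.
Qed.

Lemma deg_lt_dl d l x : deg_lt d.+1 x -> deg_lt d (dl l x).
Proof.
move=> xd S m le_m; rewrite sum_ffunE raddf_sum big1 //= => k _.
by rewrite ssZE mcoeffZ (deg_lt_deriv k xd) ?mulr0.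
Qed.

End InvariantOperators.

(** * Differentially closed power ideals *)

Section PowerIdeals.
Variables (F : fieldType) (L : vectType F).
Hypothesis char0 : forall n, n.+1%:R != 0 :> F.
Notation Psi := (superspace F (\dim {:L})).
Notation form := 'Hom(L, F^o).
Implicit Types (x y z : Psi) (u v w : L) (l f e : form) (W : {vspace L})
  (rho : L -> nat) (N M : L -> Prop).

Lemma lformZ l (a : F) v : l (a *: v) = (a * l v : F).
Proof. exact: linearZ. Qed.

Lemma lform_comb l f (a : F) v : (a *: l + f) v = (a * l v + f v : F).
Proof. by rewrite add_lfunE scale_lfunE. Qed.

(* Membership in Sym W (x) /\L. *)
Definition symin W x := forall l, (forall w, w \in W -> l w = 0) -> dl l x = 0.

Lemma symin0 W : symin W 0.
Proof. by move=> l _; rewrite linear0. Qed.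

Lemma syminD W x y : symin W x -> symin W y -> symin W (x + y).
Proof. by move=> hx hy l hl; rewrite linearD /= hx // hy // addr0. Qed.

Lemma syminZ W a x : symin W x -> symin W (a *: x).
Proof. by move=> hx l hl; rewrite linearZ /= hx // scaler0. Qed.

Lemma syminN W x : symin W x -> symin W (- x).
Proof. by move=> hx; rewrite -scaleN1r; apply: syminZ. Qed.

Lemma symin_sv W v x : v \in W -> symin W x -> symin W (sv v * x).
Proof. by move=> vW hx l hl; rewrite dl_sv hl // scale0r add0r hx // mulr0. Qed.

Lemma symin_svX W v n x : v \in W -> symin W x -> symin W (sv v ^+ n * x).
Proof.
move=> vW hx; elim: n => [|n IHn]; first by rewrite mul1r.
by rewrite exprS -mulrA; apply: symin_sv.
Qed.

Lemma symin_tv W v x : symin W x -> symin W (tv v * x).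
Proof. by move=> hx l hl; rewrite dl_tv hx // mulr0. Qed.

Lemma symin_il W f x : symin W x -> symin W (il f x).
Proof. by move=> hx l hl; rewrite dl_il hx // linear0. Qed.

Lemma symin_dl W f x : symin W x -> symin W (dl f x).
Proof. by move=> hx l hl; rewrite dl_dl hx // linear0. Qed.

Lemma dl_ssproj0 l j x : dl l (ssproj 0 j x) = 0.
Proof.
apply: deg_lt0; apply: deg_lt_dl => S m lt0m; rewrite ffunE.
case: ifP => _; last by rewrite mcoeff0.
by rewrite mcoeff_pihomog; case: eqP lt0m => // ->.
Qed.

Lemma symin_ssproj W i j x : symin W x -> symin W (ssproj i j x).
Proof.
move=> hx l hl; case: i => [|i]; first exact: dl_ssproj0.
by rewrite -ssproj_dl hx // linear0.
Qed.

Lemma symin_sub W1 W2 x : (W1 <= W2)%VS -> symin W1 x -> symin W2 x.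
Proof. by move=> /subvP sW hx l hl; apply: hx => w /sW; apply: hl. Qed.

Lemma symin_full x : symin fullv x.
Proof.
move=> l hl; rewrite /dl big1 // => k _.
by rewrite hl ?memvf // scale0r.
Qed.

(** A form vanishing on [W :&: lker f] agrees on [W] with a multiple of [f]. Its derivation
    therefore acts on x as a multiple of [dl f], that is, by 0. *)
Lemma symin_cap W f v x : v \in W -> f v != 0 ->
  symin W x -> dl f x = 0 -> symin (W :&: lker f) x.
Proof.
move=> vW fv hx fx l hl.
pose c : F := (l v : F) / (f v : F).
have := dl_linear_form (- c) f l x.
rewrite fx scaler0 add0r => <-; apply: hx => w wW; rewrite lform_comb.
have := hl (w - ((f w : F) / (f v : F)) *: v).
rewrite memv_cap memv_ker rpredB ?rpredZ // !linearB /= !lformZ.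
rewrite divfK // subrr eqxx => /(_ isT)/eqP; rewrite subr_eq0 => /eqP ->.
apply/eqP; rewrite /c mulNr addrC subr_eq0 mulrAC [_ * l v]mulrC.
by rewrite -mulrA -mulrA [_^-1 * _]mulrC.
Qed.

Lemma dl_svX l v n x : dl l (sv v ^+ n * x) =
  (n%:R * l v : F) *: (sv v ^+ n.-1 * x) + sv v ^+ n * dl l x.
Proof.
elim: n => [|n IHn]; first by rewrite !mul1r mul0r scale0r add0r.
rewrite exprS -!mulrA dl_sv IHn mulrDr addrA; congr (_ + _).
rewrite -scalerAr -[n.+1%:R]natr1 mulrDl mul1r scalerDl addrC; congr (_ + _).
by case: n {IHn} => [|n]; rewrite ?mul0r ?scale0r //= mulrA exprS.
Qed.

(* On polynomials in v this inverts v ^ k |-> (m + 1 + k) (f v) v ^ k; dl f is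
   locally nilpotent, which gives the induction. *)
Lemma euler_solve W f v m y : v \in W -> f v != 0 -> symin W y ->
  exists2 z, symin W z & (m.+1%:R * f v : F) *: z + sv v * dl f z = y.
Proof.
move=> vW fv; have [d] := deg_lt_exists y.
elim: d m y => [|d IHd] m y hd hy.
  exists 0; first exact: symin0.
  by rewrite !linear0 mulr0 addr0 (deg_lt0 hd).
(* Applying [dl f] to the wanted equation shows that [dl f z] must solve the same equation with
   [m.+1] and right side [dl f y]. The induction supplies that value, and the equation then
   determines z. *)
have [z hz ez] := IHd m.+1 (dl f y) (deg_lt_dl f hd) (symin_dl f hy).
pose c : F := m.+1%:R * f v.
have c0 : c != 0 by rewrite mulf_neq0.
exists (c^-1 *: (y - sv v * z)).
  by apply/syminZ/syminD => //; apply/syminN/symin_sv.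
rewrite -/c scalerA divff // scale1r linearZ linearB /= dl_sv -ez.
have -> : (m.+2%:R * f v) *: z = c *: z + f v *: z.
  by rewrite -scalerDl -[m.+2%:R]natr1 mulrDl mul1r.
have -> : c *: z + f v *: z + sv v * dl f z - (f v *: z + sv v * dl f z) = c *: z.
  by rewrite -[X in X - _]addrA addrK.
by rewrite scalerA mulVf // scale1r subrK.
Qed.

Lemma integrate W f v y : v \in W -> f v != 0 -> symin W y ->
  exists2 z, symin W z & dl f z = y.
Proof.
move=> vW fv hy; have [z hz ez] := euler_solve 0 vW fv hy.
by exists (sv v * z); [apply: symin_sv | rewrite dl_sv -ez mul1r].
Qed.

(* The ideal of Sym W (x) /\L generated by v ^ rho v and its exterior derivative,
   v in W nonzero, and by the theta_v with N v. Here N collects the directions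
   of the coloops that have been removed. *)
Inductive J W rho N : Psi -> Prop :=
| J0 : J W rho N 0
| JD x y : J W rho N x -> J W rho N y -> J W rho N (x + y)
| Jpow v y : v \in W -> v != 0 -> symin W y -> J W rho N (sv v ^+ rho v * y)
| Jdpow v y : v \in W -> v != 0 -> symin W y ->
    J W rho N (sv v ^+ (rho v).-1 * (tv v * y))
| Jtv v y : N v -> symin W y -> J W rho N (tv v * y).

Section IdealTheory.
Variables (W : {vspace L}) (rho : L -> nat) (N : L -> Prop).
Notation JW := (J W rho N).

Lemma JZ a x : JW x -> JW (a *: x).
Proof.
elim=> {x} [|x y _ IHx _ IHy|v y vW v0 hy|v y vW v0 hy|v y vN hy].
- by rewrite scaler0; apply: J0.
- by rewrite scalerDr; apply: JD.
- by rewrite scalerAr; apply: Jpow => //; apply: syminZ.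
- by rewrite !scalerAr; apply: Jdpow => //; apply: syminZ.
- by rewrite scalerAr; apply: Jtv => //; apply: syminZ.
Qed.

Lemma JN x : JW x -> JW (- x).
Proof. by rewrite -scaleN1r; apply: JZ. Qed.

Lemma JB x y : JW x -> JW y -> JW (x - y).
Proof. by move=> hx hy; apply: JD hx (JN hy). Qed.

Lemma J_sum (I : finType) (h : I -> Psi) : (forall i, JW (h i)) -> JW (\sum_i h i).
Proof.
by move=> hh; elim/big_rec: _ => [|i x _ hx]; [apply: J0 | apply: JD].
Qed.

Lemma J_symin x : JW x -> symin W x.
Proof.
elim=> {x} [|x y _ IHx _ IHy|v y vW v0 hy|v y vW v0 hy|v y vN hy].
- exact: symin0.
- exact: syminD.
- exact: symin_svX.
- by apply/symin_svX/symin_tv.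
- exact: symin_tv.
Qed.

Lemma J_sv v x : v \in W -> JW x -> JW (sv v * x).
Proof.
move=> vW; elim=> {x} [|x y _ IHx _ IHy|u y uW u0 hy|u y uW u0 hy|u y uN hy].
- by rewrite mulr0; apply: J0.
- by rewrite mulrDr; apply: JD.
- by rewrite mulrA -svXC -mulrA; apply: Jpow => //; apply: symin_sv.
- rewrite mulrA -svXC -mulrA -svCA; apply: Jdpow => //; exact: symin_sv.
- by rewrite -svCA; apply: Jtv => //; apply: symin_sv.
Qed.

Lemma J_svX v n x : v \in W -> JW x -> JW (sv v ^+ n * x).
Proof.
move=> vW hx; elim: n => [|n IHn]; first by rewrite mul1r.
by rewrite exprS -mulrA; apply: J_sv.
Qed.

Lemma J_tv v x : JW x -> JW (tv v * x).
Proof.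
elim=> {x} [|x y _ IHx _ IHy|u y uW u0 hy|u y uW u0 hy|u y uN hy].
- by rewrite mulr0; apply: J0.
- by rewrite mulrDr; apply: JD.
- by rewrite mulrA -svXC -mulrA; apply: Jpow => //; apply: symin_tv.
- rewrite mulrA -svXC -mulrA tvCA mulrN; apply: JN.
  by apply: Jdpow => //; apply: symin_tv.
- by rewrite tvCA; apply/JN/Jtv => //; apply: symin_tv.
Qed.

Lemma Jpow_ge v n y : v \in W -> v != 0 -> (rho v <= n)%N -> symin W y ->
  JW (sv v ^+ n * y).
Proof.
move=> vW v0 le_n hy; rewrite -(subnK le_n) exprD -mulrA.
by apply: J_svX => //; apply: Jpow.
Qed.

Lemma Jdpow_ge v n y : v \in W -> v != 0 -> ((rho v).-1 <= n)%N -> symin W y ->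
  JW (sv v ^+ n * (tv v * y)).
Proof.
move=> vW v0 le_n hy; rewrite -(subnK le_n) exprD -mulrA.
by apply: J_svX => //; apply: Jdpow.
Qed.

Lemma J_ssproj i j x : JW x -> JW (ssproj i j x).
Proof.
elim=> {x} [|x y _ IHx _ IHy|u y uW u0 hy|u y uW u0 hy|u y uN hy].
- by rewrite linear0; apply: J0.
- by rewrite linearD; apply: JD.
- rewrite ssproj_svX; case: ifP => _; last exact: J0.
  by apply: Jpow => //; apply: symin_ssproj.
- rewrite ssproj_svX; case: ifP => _; last exact: J0.
  case: j => [|j]; first by rewrite ssproj0_tv mulr0; apply: J0.
  by rewrite ssproj_tv; apply: Jdpow => //; apply: symin_ssproj.
- case: j => [|j]; first by rewrite ssproj0_tv; apply: J0.
  by rewrite ssproj_tv; apply: Jtv => //; apply: symin_ssproj.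
Qed.

(** Contracting theta_v yields the scalar e v. As it is 0 for all generators, [il e] passes through
    each of them up to sign and acts on the cofactor only. *)
Lemma J_il e x : (forall v, v \in W -> e v = 0) -> (forall v, N v -> e v = 0) ->
  JW x -> JW (il e x).
Proof.
move=> eW eN; have il_svX v n y : il e (sv v ^+ n * y) = sv v ^+ n * il e y.
  by elim: n => [|n IHn]; rewrite ?mul1r // exprS -!mulrA il_sv IHn.
elim=> {x} [|x y _ IHx _ IHy|u y uW u0 hy|u y uW u0 hy|u y uN hy].
- by rewrite linear0; apply: J0.
- by rewrite linearD; apply: JD.
- by rewrite il_svX; apply: Jpow => //; apply: symin_il.
- rewrite il_svX il_tv eW // scale0r sub0r mulrN; apply: JN.
  by apply: Jdpow => //; apply: symin_il.
- by rewrite il_tv eN // scale0r sub0r; apply/JN/Jtv => //; apply: symin_il.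
Qed.

End IdealTheory.

(** The alternative in the last hypothesis absorbs a direction of [N1]: if [rho2 v] is 0 or 1, the
    generator with exponent [(rho2 v).-1] is theta_v itself. Coloop directions are traded against
    powers in this way. *)
Lemma J_mono W1 W2 rho1 rho2 (N1 N2 : L -> Prop) x : (W1 <= W2)%VS ->
  (forall v, v \in W1 -> v != 0 -> (rho2 v <= rho1 v)%N) ->
  (forall v, N1 v -> N2 v \/ [/\ v \in W2, v != 0 & (rho2 v <= 1)%N]) ->
  J W1 rho1 N1 x -> J W2 rho2 N2 x.
Proof.
move=> sW le_rho sN; have sub := symin_sub sW.
elim=> {x} [|x y _ IHx _ IHy|u y uW u0 hy|u y uW u0 hy|u y uN hy].
- exact: J0.
- exact: JD.
- by apply: Jpow_ge (sub _ hy); rewrite ?(subvP sW) ?le_rho.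
- by apply: Jdpow_ge (sub _ hy); rewrite ?(subvP sW) // -!subn1 leq_sub2r ?le_rho.
- case: (sN u uN) => [uN2|[uW u0 ru]]; first exact: Jtv (sub _ hy).
  rewrite -[tv u * y]mul1r -(expr0 (sv u)); apply: Jdpow_ge (sub _ hy) => //.
  by case: (rho2 u) ru => [|[]].
Qed.

(** Isolates what the directions on one line contribute: a single multiple of theta_u, with no
    control on its cofactor. *)
Lemma J_line_decomp W rho N M u x : (forall v, M v -> exists c, v = c *: u) ->
  J W rho (fun v => N v \/ M v) x ->
  exists a b, [/\ J W rho N a, symin W b & x = a + tv u * b].
Proof.
move=> Mu; have addJ a : J W rho N a ->
    exists a' b, [/\ J W rho N a', symin W b & a = a' + tv u * b].
  by move=> ha; exists a, 0; split; rewrite ?mulr0 ?addr0 //; apply: symin0.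
elim=> {x} [|x y _ [a [b [ha hb ->]]] _ [a' [b' [ha' hb' ->]]]
  |v y vW v0 hy|v y vW v0 hy|v y vN hy].
- exact/addJ/J0.
- exists (a + a'), (b + b'); split; [exact: JD | exact: syminD |].
  by rewrite mulrDr addrACA.
- exact/addJ/Jpow.
- exact/addJ/Jdpow.
- case: vN => [vN|/Mu[c ->]]; first exact/addJ/Jtv.
  exists 0, (c *: y); split; [exact: J0 | exact: syminZ |].
  by rewrite add0r linearZ /= -scalerAl -scalerAr.
Qed.

(** Anticommutation gives only 2 theta_v theta_v = 0, so 2 has to be invertible. *)
Lemma tv_sqrM v x : tv v * (tv v * x) = 0.
Proof.
have /eqP := tvCA v v x; rewrite -addr_eq0 -mulr2n -scaler_nat scaler_eq0.
by rewrite (negPf (char0 1)) => /eqP.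
Qed.

(* If x = a + theta_u b then (e u) theta_u b = theta_u (il e x) - theta_u (il e a). *)
Lemma J_line_elim W rho N M u e x :
  (forall v, M v -> exists c, v = c *: u) -> e u != 0 ->
  (forall v, v \in W -> e v = 0) -> (forall v, N v -> e v = 0) ->
  J W rho (fun v => N v \/ M v) x -> J W rho (fun v => N v \/ M v) (il e x) ->
  J W rho N x.
Proof.
move=> Mu eu eW eN /(J_line_decomp Mu)[a [b [ha hb ->]]].
move=> /(J_line_decomp Mu)[a' [b' [ha' _ eab]]].
apply: JD => //; rewrite -[tv u * b]scale1r -(mulVf eu) -scalerA; apply: JZ.
suff -> : e u *: (tv u * b) = tv u * a' - tv u * il e a.
  by apply: JB; apply: J_tv => //; apply: J_il.
have := congr1 (fun y => tv u * y) eab.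
rewrite linearD /= il_tv !mulrDr tv_sqrM addr0 mulrN tv_sqrM subr0 => <-.
by rewrite addrAC subrr add0r -scalerAr.
Qed.

Lemma symin_sseval0 W x : symin W (sseval0 x).
Proof.
move=> l _; apply: deg_lt0; apply: deg_lt_dl => S m lem.
rewrite ffunE mcoeffC; case: (eqVneq m 0%MM) lem => [->|_ _]; last by rewrite mulr0.
by rewrite mdeg0.
Qed.

Lemma symin_const x : symin 0 x -> sseval0 x = x.
Proof.
move=> hx; apply: sseval0_id => // k.
pose l : form := linfun (coord (vbasis {:L}) k : L -> F^o).
have <- : dl l x = ssderiv k x.
  rewrite /dl (bigD1 k) //= big1 ?addr0 => [|i nik];
    rewrite lfunE /= coord_free ?(basis_free (vbasisP _)) //.
    by rewrite eqxx scale1r.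
  by rewrite (negPf nik) scale0r.
by apply: hx => w; rewrite memv0 => /eqP->; rewrite linear0.
Qed.

End PowerIdeals.

(** * Deletion and restriction of the ideals *)

Section ContractionOperators.
Variables (F : fieldType) (L : vectType F).
Notation Psi := (superspace F (\dim {:L})).
Notation form := 'Hom(L, F^o).
Implicit Types (x y z : Psi) (u v w : L) (l f e : form) (W : {vspace L})
  (T : seq form).

Definition ilT T x : Psi := foldr (@il F L) x T.

(* The supercommutator of d with ilT T. *)
Fixpoint DT T x : Psi :=
  if T is e :: T' then dl e (ilT T' x) - il e (DT T' x) else 0.

(* The commutator of DT T with multiplication by sv v. *)
Fixpoint CT T v x : Psi :=
  if T is e :: T' then e v *: ilT T' x - il e (CT T' v x) else 0.

Lemma ilT_is_linear T : linear (ilT T).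
Proof.
by elim: T => [|e T IHT] // a x y; rewrite /ilT /= -!/(ilT T _) IHT linearP.
Qed.
HB.instance Definition _ T :=
  GRing.isLinear.Build F Psi Psi _ (ilT T) (ilT_is_linear T).

Lemma DT_is_linear T : linear (DT T).
Proof.
elim: T => [|e T IHT] a x y /=; first by rewrite scaler0 addr0.
by rewrite IHT linearP [dl e _]linearP [il e _]linearP opprD addrACA -scalerBr.
Qed.
HB.instance Definition _ T :=
  GRing.isLinear.Build F Psi Psi _ (DT T) (DT_is_linear T).

Lemma symin_ilT W T x : symin W x -> symin W (ilT T x).
Proof. by move=> hx; elim: T => [|e T IHT] //=; apply: symin_il. Qed.

Lemma symin_DT W T x : symin W x -> symin W (DT T x).
Proof.
move=> hx; elim: T => [|e T IHT] /=; first exact: symin0.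
apply: syminD; first exact/symin_dl/symin_ilT.
exact/syminN/symin_il.
Qed.

Lemma symin_CT W T v x : symin W x -> symin W (CT T v x).
Proof.
move=> hx; elim: T => [|e T IHT] /=; first exact: symin0.
apply: syminD; first exact/syminZ/symin_ilT.
exact/syminN/symin_il.
Qed.

(** Unfolding the recursion, every summand contains some [dl e] with e in [T], and these kill the
    ring over [W]. Hence [DT (f :: T)] reduces there to [dl f] composed with [ilT T]. *)
Lemma DT_symin W T x : (forall e v, e \in T -> v \in W -> e v = 0) ->
  symin W x -> DT T x = 0.
Proof.
move=> eW hx; elim: T eW => //= e T IHT eW.
rewrite IHT ?linear0 ?addr0 => [|f v fT]; last by apply: eW; rewrite inE fT orbT.
by apply: (symin_ilT T hx) => v; apply: eW; rewrite inE eqxx.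
Qed.

Lemma ilT_sv T v x : ilT T (sv v * x) = sv v * ilT T x.
Proof. by elim: T => //= e T ->; rewrite il_sv. Qed.

Lemma DT_sv T v x : DT T (sv v * x) = CT T v x + sv v * DT T x.
Proof.
elim: T => [|e T IHT] /=; first by rewrite mulr0 addr0.
rewrite ilT_sv IHT dl_sv linearD /= il_sv mulrBr opprD !addrA; congr (_ + _).
by rewrite addrAC.
Qed.

Lemma CT_sv T u v x : CT T u (sv v * x) = sv v * CT T u x.
Proof.
elim: T => [|e T IHT] /=; first by rewrite mulr0.
by rewrite ilT_sv IHT il_sv mulrBr -scalerAr.
Qed.

(** [CT T v] commutes with [sv v], so [DT T] obeys the power rule of a first-order operator. At n =
    0 the truncated exponent is multiplied by 0. *)
Lemma DT_svX T v n x : DT T (sv v ^+ n * x) =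
  n%:R *: (sv v ^+ n.-1 * CT T v x) + sv v ^+ n * DT T x.
Proof.
have CT_svX m y : CT T v (sv v ^+ m * y) = sv v ^+ m * CT T v y.
  by elim: m => [|m IHm]; rewrite ?mul1r // exprS -!mulrA CT_sv IHm.
elim: n => [|n IHn]; first by rewrite scale0r add0r !mul1r.
rewrite exprS -!mulrA DT_sv IHn mulrDr addrA; congr (_ + _).
rewrite CT_svX -scalerAr -[n.+1%:R]natr1 scalerDl scale1r addrC; congr (_ + _).
by case: n {IHn} => [|n]; rewrite ?scale0r //= mulrA exprS.
Qed.

(** By the Jacobi identity the commutator of [d, iota_T] with v equals, up to sign, the
    supercommutator of iota_T with theta_v = [d, v]. So the same [CT] measures both failures. *)
Lemma ilT_tv T v x :
  ilT T (tv v * x) = (-1) ^+ size T *: (tv v * ilT T x - CT T v x).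
Proof.
elim: T => [|e T IHT] /=; first by rewrite scale1r subr0.
rewrite IHT linearZ /= linearB /= il_tv exprS -scalerA scaleN1r -scalerN.
by congr (_ *: _); rewrite !opprB addrAC.
Qed.

(** [CT T v] already contracts against theta_v. A second contraction against the same vector
    cancels, so only the sign of an operator lowering the exterior degree by [size T] minus 1
    remains. *)
Lemma CT_tv T v x : CT T v (tv v * x) = (-1) ^+ (size T).+1 *: (tv v * CT T v x).
Proof.
elim: T => [|e T IHT] /=; first by rewrite mulr0 scaler0.
rewrite ilT_tv IHT [il e _]linearZ /= il_tv !exprS -!scalerA !scaleN1r !opprK.
rewrite mulrBr -scalerAr scalerA mulrC -scalerA -scalerDr; congr (_ *: _).
by rewrite scalerBr addrA subrK.
Qed.

Lemma CT0 T v x : (forall e, e \in T -> e v = 0) -> CT T v x = 0.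
Proof.
elim: T => //= e T IH h; rewrite h ?inE ?eqxx // scale0r IH ?linear0 ?addr0 //.
by move=> f fT; rewrite h // inE fT orbT.
Qed.

Lemma DT_tv0 T v x : (forall e, e \in T -> e v = 0) ->
  DT T (tv v * x) = (-1) ^+ (size T).+1 *: (tv v * DT T x).
Proof.
elim: T => [|e T IHT] h /=; first by rewrite mulr0 scaler0.
have hT f : f \in T -> f v = 0 by move=> fT; rewrite h // inE fT orbT.
rewrite ilT_tv CT0 // subr0 [dl e _]linearZ /= dl_tv IHT // [il e _]linearZ /= il_tv.
rewrite h ?inE ?eqxx // scale0r sub0r !exprS -!scalerA !scaleN1r scalerN !opprK.
by rewrite mulrBr scalerBr.
Qed.

End ContractionOperators.

Section DeletionRestriction.
Variables (F : fieldType) (L : vectType F) (n : nat).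
Variable ell : 'I_n -> 'Hom(L, F^o).
Hypothesis char0 : forall n, n.+1%:R != 0 :> F.
Notation Psi := (superspace F (\dim {:L})).
Implicit Types (x y z : Psi) (u v w h : L) (W : {vspace L})
  (N M : L -> Prop) (A B : {set 'I_n}) (i e f : 'I_n).

Definition rhoA A v : nat := #|[set i in A | ell i v != 0]|.

Definition essential W A :=
  forall v, v \in W -> (forall i, i \in A -> ell i v = 0) -> v = 0.

(** For such v the generator v ^ (rho - 1) theta_v has exponent 0, so theta_v itself is in the
    ideal. *)
Definition coloopdir W A v := v \in W /\ rhoA A v = 1%N.

Lemma rhoA_eq0 A v : rhoA A v = 0%N -> forall i, i \in A -> ell i v = 0.
Proof.
move=> /eqP; rewrite cards_eq0 => /eqP/setP A0 i iA; apply/eqP.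
by have := A0 i; rewrite !inE iA /= => /negbFE.
Qed.

Lemma essential_rhoA W A v :
  essential W A -> v \in W -> v != 0 -> (0 < rhoA A v)%N.
Proof.
move=> essW vW; apply: contraNltn; rewrite leqn0 => /eqP/rhoA_eq0 A0.
by apply/eqP/essW.
Qed.

Lemma rhoA_set1D A f v : f \in A -> rhoA A v = ((ell f v != 0)%R + rhoA (A :\ f) v)%N.
Proof.
move=> fA; rewrite /rhoA (cardsD1 f) !inE fA /=; congr (_ + _)%N.
by apply: eq_card => i; rewrite !inE andbA.
Qed.

Lemma rhoA_del A f v : ell f v = 0 -> rhoA (A :\ f) v = rhoA A v.
Proof.
move=> fv; apply: eq_card => i; rewrite !inE.
by case: eqP => [->|]; rewrite ?fv ?eqxx ?andbF.
Qed.

Lemma rhoA_le A v w :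
  (forall i, i \in A -> ell i v = 0 -> ell i w = 0) -> (rhoA A w <= rhoA A v)%N.
Proof.
move=> hA; apply/subset_leq_card/subsetP => i; rewrite !inE => /andP[iA].
by rewrite iA; apply: contraNneq => /(hA i iA)->.
Qed.

(* Vectors spanning the new coloop created in A :\ f when e, f are in series. *)
Definition seriesdir W A f e u :=
  [/\ u \in W, ell f u != 0 & forall i, i \in A -> i != e -> i != f -> ell i u = 0].

(** The difference of the two sides is killed by all of [A]. This makes the directions attached to
    one coloop, or to one series pair, a single line. *)
Lemma essential_scale W A u v i : essential W A -> u \in W -> v \in W ->
  (forall j, j \in A -> j != i -> ell j u = 0 /\ ell j v = 0) ->
  ell i u != 0 -> v = ((ell i v : F) / (ell i u : F)) *: u.
Proof.
move=> essW uW vW huv iu; apply/eqP; rewrite -subr_eq0; apply/eqP/essW.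
  by rewrite rpredB ?rpredZ.
move=> j jA; rewrite linearB /= lformZ; case: (eqVneq j i) => [->|/(huv j jA)[-> ->]].
  by rewrite divfK ?subrr.
by rewrite mulr0 subrr.
Qed.

Lemma seriesdir_neq0 W A f e u : essential W (A :\ f) -> e \in A -> e != f ->
  seriesdir W A f e u -> ell e u != 0.
Proof.
move=> essW eA nef [uW fu hu]; apply: contra_neq fu => eu0.
have -> : u = 0; last by rewrite linear0.
apply: essW => // j; rewrite !inE => /andP[njf jA].
by case: (eqVneq j e) => [->|nje] //; apply: hu.
Qed.

Lemma expr_sv_shift W h u (c : F) k y : h \in W -> u \in W -> symin W y ->
  exists2 g, symin W g &
    sv (h + c *: u) ^+ k * y = sv h ^+ k * y + sv u * g.
Proof.
move=> hW uW hy; elim: k => [|k [g hg eg]].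
  by exists 0; [exact: symin0 | rewrite mulr0 addr0].
exists (sv (h + c *: u) * g + c *: (sv h ^+ k * y)).
  apply: syminD; first by apply: symin_sv => //; rewrite rpredD ?rpredZ.
  by apply/syminZ/symin_svX.
rewrite !exprS -!mulrA eg mulrDr svCA {1}linearD /= mulrDl.
rewrite -addrA; congr (_ + _); rewrite mulrDr addrC; congr (_ + _).
by rewrite linearZ /= -scalerAl scalerAr.
Qed.

(** * Behaviour of the ideal when a form that is not a coloop is deleted *)

Section Deletion.
Variables (W : {vspace L}) (A : {set 'I_n}) (f : 'I_n) (N : L -> Prop).
Hypotheses (fA : f \in A) (essf : essential W (A :\ f)).

(** If f v is nonzero, deleting [f] lowers rho by one. Otherwise some e in [T] is nonzero on v, and
    its series direction u has rho 1 in [A :\ f]. Then u and theta_u are in the ideal, and v may be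
    replaced by a translate along u on which e vanishes. *)
Lemma J_deletion_low (T : seq 'I_n) v : v \in W -> v != 0 ->
  (forall e, e \in T ->
     [/\ e \in A, e != f & exists u, seriesdir W A f e u]) ->
  ~ (forall e, e \in f :: T -> ell e v = 0) ->
  (forall y, symin W y -> J W (rhoA (A :\ f)) N (sv v ^+ (rhoA A v).-1 * y)) /\
  ((1 < rhoA A v)%N -> forall y, symin W y ->
     J W (rhoA (A :\ f)) N (sv v ^+ (rhoA A v).-2 * (tv v * y))).
Proof.
move=> vW v0 hT nv.
have [fv|fv] := eqVneq (ell f v) 0; last first.
  have e1 : rhoA A v = (rhoA (A :\ f) v).+1 by rewrite (rhoA_set1D _ fA) fv.
  rewrite e1 /=; split=> [y hy|_ y hy]; [exact: Jpow | exact: Jdpow].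
have [e eT ev] : exists2 e, e \in T & ell e v != 0.
  have /hasP[e eT ev] : has (fun e => ell e v != 0) T; last by exists e.
  apply/negPn/negP => /hasPn nT; apply: nv => e; rewrite inE => /orP[/eqP->//|/nT].
  by move/negPn/eqP.
have [eA nef [u su]] := hT e eT; have [uW fu hu] := su.
have eu := seriesdir_neq0 essf eA nef su.
(* This [c] makes e vanish on [h], which lowers rho. Since f v = 0 and f u is nonzero, f h is
   nonzero, so [h] is a legitimate generator. *)
pose c : F := (ell e v : F) / (ell e u : F).
have c0 : c != 0 by rewrite mulf_neq0 ?invr_eq0.
pose h := v - c *: u; have ev_hu : v = h + c *: u by rewrite subrK.
have hW : h \in W by rewrite rpredB ?rpredZ.
have eh : ell e h = 0 by rewrite linearB /= lformZ divfK // subrr.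
have fh : ell f h != 0.
  by rewrite linearB /= lformZ fv sub0r oppr_eq0 mulf_neq0.
have h0 : h != 0 by apply: contra_neq fh => ->; rewrite linear0.
have u0 : u != 0 by apply: contra_neq fu => ->; rewrite linear0.
have rh : (rhoA (A :\ f) h <= (rhoA A v).-1)%N.
  rewrite -(rhoA_del A fv) (@rhoA_set1D (A :\ f) e v) ?inE ?nef // ev /=.
  rewrite (@rhoA_set1D (A :\ f) e h) ?inE ?nef // eh eqxx /= add0n.
  apply: rhoA_le => i; rewrite !inE => /and3P[nie nif iA] iv.
  by rewrite linearB /= lformZ iv hu // mulr0 subrr.
have ru : rhoA (A :\ f) u = 1%N.
  rewrite (@rhoA_set1D (A :\ f) e) ?inE ?nef // eu; congr _.+1.
  apply/eqP; rewrite cards_eq0; apply/eqP/setP => i; rewrite !inE.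
  by apply/negP => /andP[/and3P[nie nif iA]]; rewrite hu ?eqxx.
have Ju y : symin W y -> J W (rhoA (A :\ f)) N (sv u * y).
  by move=> hy; rewrite -[sv u]expr1; apply: Jpow_ge; rewrite ?ru.
have Jtu y : symin W y -> J W (rhoA (A :\ f)) N (tv u * y).
  move=> hy; rewrite -[tv u * y]mul1r -(expr0 (sv u)).
  by apply: Jdpow_ge; rewrite ?ru.
split=> [y hy|r2 y hy].
  have [g hg] := expr_sv_shift c (rhoA A v).-1 hW uW hy; rewrite -ev_hu => ->.
  by apply: JD; [apply: Jpow_ge | apply: Ju].
have [g hg] := expr_sv_shift c (rhoA A v).-2 hW uW (symin_tv v hy).
rewrite -ev_hu => ->; apply: JD; last exact: Ju.
have -> : tv v = tv h + c *: tv u by rewrite {1}ev_hu linearD /= linearZ.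
rewrite mulrDl mulrDr; apply: JD.
  by apply: Jdpow_ge => //; rewrite -!subn1 leq_sub2r ?subn1.
by apply: J_svX => //; rewrite -scalerAl; apply/JZ/Jtu/hy.
Qed.

(** By the power rule, a generator attached to v loses at most one power of v. If [f :: T] vanishes
    on v, the lossy [CT] term is 0 and deleting [f] does not change rho v. Otherwise
    [J_deletion_low] accepts the lower power. *)
Lemma DT_J (T : seq 'I_n) x : (forall v i, N v -> i \in A -> ell i v = 0) ->
  (forall e, e \in T ->
     [/\ e \in A, e != f & exists u, seriesdir W A f e u]) ->
  J W (rhoA A) N x -> J W (rhoA (A :\ f)) N (DT (map ell (f :: T)) x).
Proof.
move=> NA hT; pose T' := map ell (f :: T); rewrite -/T'.
have TA e : e \in f :: T -> e \in A by rewrite inE => /orP[/eqP->|/hT[]].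
have vanish v : (forall e, e \in f :: T -> ell e v = 0) ->
    forall l, l \in T' -> l v = 0.
  by move=> hv l /mapP[e eT ->]; apply: hv.
have dec v : (forall e, e \in f :: T -> ell e v = 0) \/
    ~ (forall e, e \in f :: T -> ell e v = 0).
  case: (boolP (all (fun e => ell e v == 0) (f :: T))) => [/allP h|/allPn[e eT ev]].
    by left=> e /h/eqP.
  by right=> h; rewrite h ?eqxx in ev.
move: T' vanish => T' vanish.
elim=> {x} [|x y _ IHx _ IHy|v y vW v0 hy|v y vW v0 hy|v y vN hy].
- by rewrite linear0; apply: J0.
- by rewrite linearD; apply: JD.
- rewrite DT_svX; case: (dec v) => [hv|nv].
    rewrite CT0 ?mulr0 ?scaler0 ?add0r; last exact: vanish.
    rewrite -(@rhoA_del A f); last by rewrite hv ?inE ?eqxx.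
    by apply: Jpow => //; apply: symin_DT.
  have [Jlow _] := J_deletion_low vW v0 hT nv.
  apply: JD; first by apply/JZ/Jlow/symin_CT.
  have := Jlow _ (symin_DT T' hy); case: (rhoA A v) => // m /(J_sv vW).
  by rewrite exprS -mulrA.
- rewrite DT_svX; case: (dec v) => [hv|nv].
    rewrite CT0 ?mulr0 ?scaler0 ?add0r; last exact: vanish.
    rewrite DT_tv0; last exact: vanish.
    rewrite -scalerAr; apply: JZ; rewrite -(@rhoA_del A f); last by rewrite hv ?inE ?eqxx.
    by apply: Jdpow => //; apply: symin_DT.
  have [Jlow Jlow2] := J_deletion_low vW v0 hT nv.
  apply: JD; last by apply/Jlow/symin_DT/symin_tv.
  (* For rho at most 1 the coefficient [(rhoA A v).-1] is 0; otherwise the exponent [(rhoA A v).-2]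
     is a true subtraction. *)
  case: (leqP (rhoA A v) 1) => [|r2].
    by case: (rhoA A v) => [|[]] // _; rewrite scale0r; apply: J0.
  apply: JZ; rewrite CT_tv -scalerAr; apply: JZ.
  exact/(Jlow2 r2)/symin_CT.
- rewrite DT_tv0; last by apply: vanish => e /TA; apply: NA.
  by apply/JZ/Jtv => //; apply: symin_DT.
Qed.

Lemma J_dl x : (forall v i, N v -> i \in A -> ell i v = 0) ->
  J W (rhoA A) N x -> J W (rhoA (A :\ f)) N (dl (ell f) x).
Proof.
by move=> NA /(@DT_J [::])-/(_ NA) /=; rewrite linear0 subr0; apply.
Qed.

(** If f u = 0, the power of u is constant for [dl (ell f)] and only the cofactor is integrated,
    along v. Otherwise the exponent is raised by one, as rho allows when [f] is put back, and
    [euler_solve] finds the cofactor. *)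
Lemma J_dl_lift v y : v \in W -> ell f v != 0 -> J W (rhoA (A :\ f)) N y ->
  exists2 z, J W (rhoA A) N z & dl (ell f) z = y.
Proof.
move=> vW fv.
elim=> {y} [|x y _ [x' Jx <-] _ [y' Jy <-]|u y uW u0 hy|u y uW u0 hy|u y uN hy].
- by exists 0; [exact: J0 | rewrite linear0].
- by exists (x' + y'); [exact: JD | rewrite linearD].
- have [fu|fu] := eqVneq (ell f u) 0.
    have [z hz <-] := integrate char0 vW fv hy.
    exists (sv u ^+ rhoA A u * z); first exact: Jpow.
    by rewrite dl_svX fu mulr0 scale0r add0r rhoA_del.
  have [z hz <-] := euler_solve char0 (rhoA (A :\ f) u) uW fu hy.
  exists (sv u ^+ (rhoA (A :\ f) u).+1 * z).
    by apply: Jpow_ge => //; rewrite (rhoA_set1D _ fA) fu.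
  by rewrite dl_svX /= exprSr mulrDr -scalerAr mulrA.
- have [fu|fu] := eqVneq (ell f u) 0.
    have [z hz <-] := integrate char0 vW fv hy.
    exists (sv u ^+ (rhoA A u).-1 * (tv u * z)); first exact: Jdpow.
    by rewrite dl_svX fu mulr0 scale0r add0r rhoA_del // dl_tv.
  (* Essentiality excludes rho 0 for [A :\ f], so [m] is the exponent there and [m.+1] the one for
     [A], without truncation. *)
  have := essential_rhoA essf uW u0; case E: (rhoA (A :\ f) u) => [|m] // _.
  have [z hz <-] := euler_solve char0 m uW fu hy.
  exists (sv u ^+ m.+1 * (tv u * z)).
    by apply: Jdpow_ge => //; rewrite (rhoA_set1D _ fA) fu E.
  rewrite dl_svX /= dl_tv exprSr -mulrA -(svCA u (tv u)). rewrite scalerAr scalerAr.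
  by rewrite -!mulrDr.
- have [z hz <-] := integrate char0 vW fv hy.
  by exists (tv u * z); [apply: Jtv | rewrite dl_tv].
Qed.

End Deletion.

Lemma rhoA0 A : rhoA A 0 = 0%N.
Proof.
apply/eqP; rewrite cards_eq0; apply/eqP/setP => i.
by rewrite !inE linear0 eqxx andbF.
Qed.

Lemma rhoA1P A v : rhoA A v = 1%N ->
  exists e, [/\ e \in A, ell e v != 0 & forall i, i \in A -> i != e -> ell i v = 0].
Proof.
move=> /eqP/cards1P[e /setP he]; have := he e; rewrite !inE eqxx => /andP[eA ev].
exists e; split=> // i iA nie; apply/eqP; have := he i.
by rewrite !inE iA (negPf nie) /= => /negbFE.
Qed.

Lemma rhoA1I A e v : e \in A -> ell e v != 0 ->
  (forall i, i \in A -> i != e -> ell i v = 0) -> rhoA A v = 1%N.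
Proof.
move=> eA ev hv; apply/eqP/cards1P; exists e; apply/setP => i; rewrite !inE.
case: (eqVneq i e) => [->|nie]; first by rewrite eA.
by case: (boolP (i \in A)) => // iA; rewrite hv ?eqxx.
Qed.

Definition cap_hyp W B := (W :&: \bigcap_(i in B) lker (ell i))%VS.

Lemma cap_hypP W B v :
  reflect (v \in W /\ forall i, i \in B -> ell i v = 0) (v \in cap_hyp W B).
Proof.
rewrite memv_cap memvE; apply: (iffP andP) => [[vW /subv_bigcapP hv]|[vW hv]].
  by split=> // i iB; have := hv i iB; rewrite -memvE memv_ker => /eqP.
by split=> //; apply/subv_bigcapP => i iB; rewrite -memvE memv_ker hv.
Qed.

Lemma not_sub_lkerP W e :
  reflect (exists2 v, v \in W & ell e v != 0) (~~ (W <= lker (ell e))%VS).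
Proof.
apply: (iffP (@subvPn _ _ W (lker (ell e)))) => -[v vW]; exists v => //.
  by rewrite -memv_ker.
by rewrite memv_ker.
Qed.

(** Such a direction exists exactly when [f] is a coloop on [W] after [e] is removed. As an
    inclusion of subspaces the condition is decidable. *)
Lemma seriesdirP W A f e :
  reflect (exists u, seriesdir W A f e u)
    (~~ (cap_hyp W (A :\ e :\ f) <= lker (ell f))%VS).
Proof.
apply: (iffP (not_sub_lkerP _ _)) => [[v /cap_hypP[vW hv] fv]|[v [vW fv hv]]].
  by exists v; split=> // i iA nie nif; apply: hv; rewrite !inE nif nie.
exists v => //; apply/cap_hypP; split=> // i; rewrite !inE => /and3P[nif nie iA].
exact: hv.
Qed.

(** * Intersecting the ideal over [W0] with the ring over a flat *)

Section Restriction.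
Variables (W0 : {vspace L}) (N : L -> Prop).

(** Setting the commuting variables to 0 fixes x and kills every generator containing a power of v.
    As rho is positive, the only survivors are theta_v with rho v = 1, and those in [N]. *)
Lemma J_const W A x : essential W0 A -> symin 0 x -> J W0 (rhoA A) N x ->
  J W (rhoA A) (fun v => N v \/ coloopdir W0 A v) x.
Proof.
move=> ess hx; rewrite -[x in X in _ -> X](symin_const char0 hx).
elim=> {x hx} [|x y _ IHx _ IHy|v y vW v0 hy|v y vW v0 hy|v y vN hy].
- by rewrite linear0; apply: J0.
- by rewrite linearD; apply: JD.
- have := essential_rhoA ess vW v0; case: (rhoA A v) => // m _.
  by rewrite exprS -mulrA sseval0_sv; apply: J0.
- have := essential_rhoA ess vW v0; case E: (rhoA A v) => [|[|m]] // _.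
    rewrite mul1r sseval0_tv; apply: Jtv; first by right.
    exact: symin_sseval0.
  by rewrite exprS -mulrA sseval0_sv; apply: J0.
- by rewrite sseval0_tv; apply: Jtv; [left | apply: symin_sseval0].
Qed.

Lemma dl_ilT l (T : seq 'Hom(L, F^o)) x : dl l (ilT T x) = ilT T (dl l x).
Proof. by elim: T => //= e T IHT; rewrite dl_il IHT. Qed.

(** If f v is nonzero, exactly one e of [A :\ f] is nonzero on v. Either e belongs to [Fs] and is in
    series with [f], or all of [Fs] vanishes on v and v lies in [W]. *)
Lemma coloopdir_deletion W A (Fs : {set 'I_n}) f v : Fs \subset A -> f \notin Fs ->
  f \in A -> (forall w, w \in W <-> w \in W0 /\ forall i, i \in Fs -> ell i w = 0) ->
  coloopdir W0 (A :\ f) v ->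
  [\/ coloopdir W0 A v, v \in W /\ rhoA (A :\ f) v = 1%N |
      exists2 e, e \in Fs & seriesdir W0 A f e v].
Proof.
move=> sFA fF fA hW [vW rv]; have [fv|fv] := eqVneq (ell f v) 0.
  by constructor 1; split=> //; rewrite -(rhoA_del A fv).
have [e [eA ev hv]] := rhoA1P rv; case: (boolP (e \in Fs)) => [eF|neF].
  constructor 3; exists e => //; split=> // i iA nie nif.
  by apply: hv => //; rewrite !inE nif.
constructor 2; split=> //; apply/hW; split=> // i iF; apply: hv.
  by rewrite !inE (subsetP sFA) // andbT; apply: contraNneq fF => <-.
by apply: contraNneq neF => <-.
Qed.

(** The series directions of one e form a line, and [ell e] vanishes on [W], on [M] and on the
    series directions of the other elements. So [J_line_elim] removes that line, given membership of
    both an element and its contraction by e. For this reason the hypothesis ranges over all [T]. *)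
Lemma series_elim W A (Fs : {set 'I_n}) f (M : L -> Prop) (S s : seq 'I_n) y :
  Fs \subset A -> f \in A -> f \notin Fs -> essential W0 (A :\ f) ->
  (forall w i, w \in W -> i \in Fs -> ell i w = 0) ->
  (forall v i, M v -> i \in S -> ell i v = 0) ->
  (forall e, e \in S -> e \in Fs /\ exists u, seriesdir W0 A f e u) ->
  uniq s -> {subset s <= S} ->
  (forall T, {subset T <= S} -> J W (rhoA (A :\ f))
     (fun v => M v \/ exists2 e, e \in s & seriesdir W0 A f e v) (ilT (map ell T) y)) ->
  J W (rhoA (A :\ f)) M y.
Proof.
move=> sFA fA fF ess WF MS hS us ss hy.
suff: forall T, {subset T <= S} -> J W (rhoA (A :\ f)) M (ilT (map ell T) y).
  by move/(_ [::]); apply.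
elim: s us ss hy => [|e s IHs] /= us ss hy.
  by move=> T /hy; apply: J_mono => // v [Mv|[i i0 _]] //; left.
case/andP: us => es us; apply: IHs => //.
  by move=> i si; apply: ss; rewrite inE si orbT.
move=> T sT; have eS : e \in S by apply: ss; rewrite inE eqxx.
have [eF [u su]] := hS e eS.
have eA := subsetP sFA e eF.
have nef : e != f by apply: contraNneq fF => <-.
have to_line x : J W (rhoA (A :\ f))
    (fun v => M v \/ exists2 i, i \in e :: s & seriesdir W0 A f i v) x ->
  J W (rhoA (A :\ f)) (fun v => (M v \/ exists2 i, i \in s & seriesdir W0 A f i v)
     \/ seriesdir W0 A f e v) x.
  apply: J_mono => // v [Mv|[i is_i sv]]; first by left; left; left.
  move: is_i sv; rewrite inE => /orP[/eqP->|si] sv; left; first by right.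
  by left; right; exists i.
apply: (@J_line_elim _ _ char0 _ _ _ (seriesdir W0 A f e) u (ell e)).
- have [uW fu hu] := su.
  move=> v [vW fv hv]; exists ((ell e v : F) / (ell e u : F)).
  apply: (essential_scale ess) => //; last exact: (seriesdir_neq0 ess).
  by move=> j; rewrite !inE => /andP[njf jA] nje; rewrite hu ?hv.
- exact: (seriesdir_neq0 ess).
- by move=> v vW; apply: WF.
- move=> v [Mv|[i si [_ _ hv]]]; first exact: MS.
  by apply: hv => //; apply: contraNneq es => ->.
- exact/to_line/hy.
- apply/to_line/(hy (e :: T)) => i; rewrite inE => /orP[/eqP->//|]; exact: sT.
Qed.

(** [W0] and [N] stay fixed in the induction on [#|A| + \dim W]: cutting [W] by a hyperplane lowers
    the dimension, deleting a form lowers the cardinality. *)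
Lemma J_restriction A W (Fs : {set 'I_n}) x : Fs \subset A ->
  (forall w, w \in W <-> w \in W0 /\ forall i, i \in Fs -> ell i w = 0) ->
  essential W0 A -> (forall v i, N v -> i \in A -> ell i v = 0) ->
  symin W x -> J W0 (rhoA A) N x ->
  J W (rhoA A) (fun v => N v \/ coloopdir W0 A v) x.
Proof.
have [m] := ubnP (#|A| + \dim W)%N; elim: m => // m IH in A W Fs x *.
move=> ltm sFA hW ess NA hx Jx; set M := fun v => _.
have sWW0 : (W <= W0)%VS by apply/subvP => w /hW[].
have [/existsP[f /andP[fA nWf]]|noF] :=
    boolP [exists f, (f \in A) && ~~ (W <= lker (ell f))%VS]; last first.
  have W_0 : W = 0%VS.
    apply/eqP; rewrite -subv0; apply/subvP => w wW; rewrite memv0; apply/eqP.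
    apply: ess => [|i iA]; first exact: (subvP sWW0).
    apply/eqP; rewrite -memv_ker; move: wW; apply/subvP.
    by move: noF; rewrite negb_exists => /forallP/(_ i); rewrite iA negbK.
  by apply: J_const => //; rewrite -W_0.
have [v vW fv] := not_sub_lkerP _ _ nWf.
have fF : f \notin Fs by apply: contraNN fv => /(proj2 (proj1 (hW v) vW))->.
pose W' := (W :&: lker (ell f))%VS.
have sW'W : (W' <= W)%VS by apply: capvSl.
have dimW' : (\dim W' < \dim W)%N.
  rewrite ltn_neqAle dimvS // andbT (dimv_leqif_sup sW'W) subv_cap subvv /=.
  exact: nWf.
have IHW' z : symin W' z -> J W0 (rhoA A) N z -> J W (rhoA A) M z.
  move=> hz Jz; apply: (@J_mono _ _ W' _ (rhoA A) _ M) => //; first by left.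
  apply: (IH A W' (f |: Fs)) => //.
    by rewrite -ltnS; apply: leq_trans ltm; rewrite ltnS ltn_add2l.
    by rewrite subUset sub1set fA.
  move=> w; rewrite memv_cap memv_ker; split.
    move=> /andP[/hW[wW wF] /eqP fw]; split=> // i; rewrite !inE => /orP[/eqP->|/wF] //.
  move=> [wW wF]; rewrite wF ?inE ?eqxx // andbT; apply/hW; split=> // i iF.
  by apply: wF; rewrite !inE iF orbT.
(* Back in the ideal over [W0], a coloop direction of [A] is redundant: its theta is a generator
   with exponent 0. Corrections of x may therefore be taken from the ideal over [W]. *)
have MW0 z : J W (rhoA A) M z -> J W0 (rhoA A) N z.
  apply: J_mono => // w [|[wW rw]]; [by left | right; split; rewrite ?rw //].
  by apply: contra_eq_neq rw => ->; rewrite rhoA0.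
have [nK|K] := boolP (~~ (cap_hyp W (A :\ f) <= lker (ell f))%VS).
  have [u /cap_hypP[uW uA] fu] := not_sub_lkerP _ _ nK.
  have ru : rhoA A u = 1%N.
    by apply: (rhoA1I fA fu) => i iA nif; apply: uA; rewrite !inE nif.
  (* Coloop case: [sv u * y] has the same image as x under [dl (ell f)] and is in the ideal because
     rho u = 1, so subtracting it moves x to the ring over [W']. *)
  have [y hy ey] := euler_solve char0 0 uW fu (symin_dl (ell f) hx).
  have Ju : J W (rhoA A) M (sv u * y).
    rewrite -[sv u]expr1; apply: Jpow_ge; rewrite ?ru //.
    by apply: contra_neq fu => ->; rewrite linear0.
  rewrite -(subrK (sv u * y) x); apply: JD => //; apply: IHW'; last exact/JB/MW0.
  apply: (symin_cap vW fv); first by apply: syminD => //; apply/syminN/symin_sv.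
  by rewrite linearB /= dl_sv -ey mul1r subrr.
move: K; rewrite negbK => /subvP K.
have essW : essential W (A :\ f).
  move=> w wW wA; apply: ess => [|i iA]; first exact: (subvP sWW0).
  case: (eqVneq i f) => [->|nif]; last by apply: wA; rewrite !inE nif.
  by apply/eqP; rewrite -memv_ker; apply: K; apply/cap_hypP.
(* [Fs] is contained in [A :\ f] and cuts [W] out of [W0], so a vector of [W0] killed by [A :\ f]
   already lies in [W]. *)
have essW0 : essential W0 (A :\ f).
  move=> w wW wA; apply: essW => //; apply/hW; split=> // i iF; apply: wA.
  by rewrite !inE (subsetP sFA) // andbT; apply: contraNneq fF => <-.
suff Jdl : J W (rhoA (A :\ f)) M (dl (ell f) x).
  have [z Jz ez] := J_dl_lift fA essW vW fv Jdl.
  rewrite -(subrK z x); apply: JD => //; apply: IHW'; last exact/JB/MW0.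
  apply: (symin_cap vW fv); first by apply/syminD/syminN/(J_symin Jz).
  by rewrite linearB /= ez subrr.
pose S := [seq e <- enum Fs | ~~ (cap_hyp W0 (A :\ e :\ f) <= lker (ell f))%VS].
have hS e : e \in S -> e \in Fs /\ exists u, seriesdir W0 A f e u.
  by rewrite mem_filter mem_enum => /andP[/seriesdirP].
(* If [i] were the form that is nonzero on a coloop direction w, then w would be a nonzero multiple
   of the series direction u of [i]. But f w = 0 while f u is nonzero. *)
have MS w i : M w -> i \in S -> ell i w = 0.
  move=> Mw /hS[iF [u su]]; have iA := subsetP sFA i iF.
  have nif : i != f by apply: contraNneq fF => <-.
  case: Mw => [Nw|[wW /rhoA1P[e [eA ew hw]]]]; first exact: NA.
  case: (eqVneq i e) => [eie|]; last exact: hw.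
  have [uW fu hu] := su; have iu := seriesdir_neq0 essW0 iA nif su.
  have ew' : w = ((ell i w : F) / (ell i u : F)) *: u.
    apply: (essential_scale essW0) => // j; rewrite !inE => /andP[njf jA] nji.
    by rewrite hu // hw // -eie.
  have := congr1 (ell f) ew'; rewrite lformZ hw //; last by rewrite -eie eq_sym.
  move/eqP; rewrite eq_sym mulf_eq0 (negPf fu) orbF.
  by rewrite mulf_eq0 invr_eq0 (negPf iu) orbF => /eqP.
apply: (@series_elim W A Fs f M S S) => //.
- by move=> w i wW iF; case/hW: wW => _; apply.
- by rewrite filter_uniq ?enum_uniq.
move=> T sT.
have TF e : e \in T -> e \in Fs by move/sT/hS => [].
have JT : J W0 (rhoA (A :\ f)) N (ilT (map ell T) (dl (ell f) x)).
  have := DT_J fA essW0 NA (T := T) (x := x).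
  rewrite /= (@DT_symin _ _ W (map ell T) x _ hx); last first.
    by move=> l w /mapP[e /TF eF ->] wW; case/hW: wW => _; apply.
  rewrite linear0 subr0 dl_ilT; apply => // e eT; have [eF ex] := hS e (sT e eT).
  by split=> //; [apply: (subsetP sFA) | apply: contraNneq fF => <-].
have ltA : (#|A :\ f| + \dim W < m)%N.
  by rewrite -ltnS; apply: leq_trans ltm; rewrite (cardsD1 f A) fA.
have sFAf : Fs \subset A :\ f.
  apply/subsetP => i iF; rewrite !inE (subsetP sFA) // andbT.
  by apply: contraNneq fF => <-.
have NAf w i : N w -> i \in A :\ f -> ell i w = 0.
  by move=> Nw; rewrite !inE => /andP[_]; apply: NA.
have := IH _ _ _ _ ltA sFAf hW essW0 NAf (symin_ilT _ (symin_dl _ hx)) JT.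
apply: J_mono => // w [Nw|cw]; first by left; left; left.
case: (coloopdir_deletion sFA fF fA hW cw) => [cA|[wW rw]|[e eF se]].
- by left; left; right.
- by right; split; rewrite ?rw //; apply: contra_eq_neq rw => ->; rewrite rhoA0.
left; right; exists e => //; rewrite mem_filter mem_enum eF andbT.
by apply/seriesdirP; exists w.
Qed.

End Restriction.

End DeletionRestriction.

(** * Exact sequences and Hilbert series *)

Section DimMod.
Variables (F : fieldType) (M : lmodType F).
Implicit Types (V I : M -> Prop).

Definition linpred V :=
  [/\ V 0, forall x y, V x -> V y -> V (x + y) & forall (a : F) x, V x -> V (a *: x)].

Lemma linpred_sum V (J : finType) (h : J -> M) :
  linpred V -> (forall k, V (h k)) -> V (\sum_k h k).
Proof.
by case=> V0 VD _ hh; elim/big_rec: _ => [|k x _ Vx]; [exact: V0 | apply: VD].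
Qed.

Lemma linpred_comb V m (b : 'I_m -> M) (c : 'I_m -> F) :
  linpred V -> (forall k, V (b k)) -> V (\sum_k c k *: b k).
Proof. by move=> lV hb; apply: linpred_sum => // k; case: lV => _ _; apply. Qed.

Lemma linpredB V x y : linpred V -> V x -> V y -> V (x - y).
Proof. by case=> _ VD VZ hx hy; apply: VD => //; rewrite -scaleN1r; apply: VZ. Qed.

(** The inclusion of [V2] in [V1] induces an isomorphism of the quotients, so the same
    representatives serve. *)
Lemma dim_mod_transfer V1 I1 V2 I2 m : linpred I1 -> linpred V2 ->
  (forall x, V2 x -> V1 x) ->
  (forall x, V1 x -> exists2 y, V2 y & I1 (x - y)) ->
  (forall y, V2 y -> (I1 y <-> I2 y)) ->
  dim_mod V2 I2 m -> dim_mod V1 I1 m.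
Proof.
move=> lI1 lV2 sV hV hI [b [Vb free_b span_b]]; exists b; split.
- by move=> k; apply: sV.
- by move=> c Ic; apply: free_b; apply/hI => //; apply: linpred_comb.
- move=> w /hV[y Vy Iy]; have [c Ic] := span_b y Vy; exists c.
  rewrite -(subrK y w) -addrA; case: (lI1) => _ ID _; apply: ID => //.
  by apply/hI => //; apply: linpredB => //; apply: linpred_comb.
Qed.

(** Additivity for 0 -> V2/I2 -> V/I -> V1/I1 -> 0, with maps [g] and [f]. Lifts along [f] of a
    basis on the right, together with [g] of a basis on the left, represent a basis in the
    middle. *)
Lemma dim_mod_exact (f g : {linear M -> M}) V1 I1 V2 I2 V I m1 m2 :
  linpred V -> linpred I -> linpred V2 -> linpred I1 ->
  (forall y, V2 y -> V (g y)) -> (forall y, V2 y -> I (g y) <-> I2 y) ->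
  (forall y, V2 y -> I1 (f (g y))) ->
  (forall x, V1 x -> exists2 y, V y & f y = x) ->
  (forall x, V x -> V1 (f x)) ->
  (forall x, V x -> I x -> I1 (f x)) ->
  (forall x, V x -> I1 (f x) -> exists2 y, V2 y & I (x - g y)) ->
  dim_mod V1 I1 m1 -> dim_mod V2 I2 m2 -> dim_mod V I (m1 + m2).
Proof.
move=> lV lI lV2 lI1 gV gI fg fsurj fV fI ker [b1 [Vb1 free1 span1]] [b2 [Vb2 free2 span2]].
have [b' hb'] : exists b' : 'I_m1 -> M, forall k, V (b' k) /\ f (b' k) = b1 k.
  have /fin_all_exists[b' hb'] : forall k, exists y, V y /\ f y = b1 k.
    by move=> k; have [y Vy ey] := fsurj _ (Vb1 k); exists y.
  by exists b'.
pose b (k : 'I_(m1 + m2)) :=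
  match split k with inl k1 => b' k1 | inr k2 => g (b2 k2) end.
have bl k : b (lshift m2 k) = b' k by rewrite /b -[lshift _ _]/(unsplit (inl k)) unsplitK.
have br k : b (rshift m1 k) = g (b2 k) by rewrite /b -[rshift _ _]/(unsplit (inr k)) unsplitK.
have sum_b c : \sum_k c k *: b k =
    \sum_k c (lshift m2 k) *: b' k + g (\sum_k c (rshift m1 k) *: b2 k).
  rewrite big_split_ord /=; congr (_ + _); first by apply: eq_bigr => k _; rewrite bl.
  by rewrite linear_sum; apply: eq_bigr => k _; rewrite br linearZ.
have Vb k : V (b k).
  by rewrite /b; case: (split k) => k'; [case: (hb' k') | apply: gV].
have f_sum c : f (\sum_k c k *: b' k) = \sum_k c k *: b1 k.
  by rewrite linear_sum; apply: eq_bigr => k _; rewrite linearZ /=; case: (hb' k) => _ ->.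
exists b; split=> // [c Ic|w Vw].
  have Vc : V (\sum_k c k *: b k) by apply: linpred_comb.
  have c1 : forall k, c (lshift m2 k) = 0.
    apply: (free1 (fun k => c (lshift m2 k))); rewrite -f_sum.
    have := fI _ Vc Ic; rewrite sum_b linearD /= => Ifc.
    rewrite -[X in I1 X](addrK (f (g (\sum_k c (rshift m1 k) *: b2 k)))).
    by apply: linpredB => //; apply: fg; apply: linpred_comb.
  have c2 : forall k, c (rshift m1 k) = 0.
    apply: (free2 (fun k => c (rshift m1 k))); apply/gI; first exact: linpred_comb.
    move: Ic; rewrite sum_b big1 ?add0r // => k _; by rewrite c1 scale0r.
  move=> k; case: (split_ordP k) => k' ->; [exact: c1 | exact: c2].
have [c1 Ic1] := span1 _ (fV _ Vw); rewrite -f_sum -linearB in Ic1.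
have Vs1 : V (\sum_k c1 k *: b' k) by apply: linpred_comb => // k; case: (hb' k).
have [y Vy Iy] := ker _ (linpredB lV Vw Vs1) Ic1.
have [c2 Ic2] := span2 y Vy.
pose c k := match split k with inl k1 => c1 k1 | inr k2 => c2 k2 end.
exists c; rewrite sum_b.
have cl k : c (lshift m2 k) = c1 k by rewrite /c -[lshift _ _]/(unsplit (inl k)) unsplitK.
have cr k : c (rshift m1 k) = c2 k by rewrite /c -[rshift _ _]/(unsplit (inr k)) unsplitK.
have -> : \sum_k c (lshift m2 k) *: b' k = \sum_k c1 k *: b' k.
  by apply: eq_bigr => k _; rewrite cl.
have -> : \sum_k c (rshift m1 k) *: b2 k = \sum_k c2 k *: b2 k.
  by apply: eq_bigr => k _; rewrite cr.
have Vs2 : V2 (\sum_k c2 k *: b2 k) by apply: linpred_comb.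
have := (gI _ (linpredB lV2 Vy Vs2)).2 Ic2; rewrite linearB => Ig.
rewrite opprD addrA -(subrK (g y) (w - _)) -addrA.
by case: lI => _ ID _; apply: ID.
Qed.

End DimMod.

(** * Additivity of bigraded generating functions *)

Section HilbertSeries.
Implicit Types (h : nat -> nat -> nat) (P : nat -> nat -> nat -> Prop) (H : Qqt).

Definition hsum h N : Qqt :=
  \sum_(i < N) \sum_(j < N) (h i j)%:R * qvar ^+ i * tvar ^+ j.

Lemma hsum_widen h N N' :
  (forall i j, (N <= i)%N || (N <= j)%N -> h i j = 0%N) -> (N <= N')%N ->
  hsum h N' = hsum h N.
Proof.
move=> hN /subnKC <-; elim: (N' - N)%N => [|k <-]; first by rewrite addn0.
rewrite addnS /hsum big_ord_recr /= [X in _ + X]big1 ?addr0 => [|j _]; last first.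
  by rewrite hN ?leq_addr // mul0r mul0r.
apply: eq_bigr => i _; rewrite big_ord_recr /= hN ?leq_addr ?orbT //.
by rewrite !mul0r addr0.
Qed.

Lemma has_Hilb_imp P1 P2 H : (forall i j m, P1 i j m -> P2 i j m) ->
  has_Hilb P1 H -> has_Hilb P2 H.
Proof. by move=> sP [h [N [hP hN ->]]]; exists h, N; split=> // i j; apply: sP. Qed.

Lemma has_Hilb_shift_q P1 P2 P H1 H2 : (forall j m, P2 0%N j m -> P 0%N j m) ->
  (forall i j m1 m2, P1 i j m1 -> P2 i.+1 j m2 -> P i.+1 j (m1 + m2)%N) ->
  has_Hilb P1 H1 -> has_Hilb P2 H2 -> has_Hilb P (qvar * H1 + H2).
Proof.
move=> P0 PS [h1 [N1 [hP1 hN1 ->]]] [h2 [N2 [hP2 hN2 ->]]].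
pose N := maxn N1 N2; pose s1 i j := if i is i'.+1 then h1 i' j else 0%N.
pose h i j := (s1 i j + h2 i j)%N.
have h1N i j : (N <= i)%N || (N <= j)%N -> h1 i j = 0%N.
  by move=> le_N; apply: hN1; case/orP: le_N; rewrite geq_max => /andP[-> _]; rewrite ?orbT.
have h2N i j : (N <= i)%N || (N <= j)%N -> h2 i j = 0%N.
  by move=> le_N; apply: hN2; case/orP: le_N; rewrite geq_max => /andP[_ ->]; rewrite ?orbT.
exists h, N.+1; split=> [[|i] j|i j|].
- exact: P0.
- exact: PS.
- case/orP=> le_N; rewrite /h h2N ?(ltnW le_N) ?orbT ?addn0 //.
    by case: i le_N => // i le_N; rewrite /= h1N // -ltnS le_N.
  by case: i => // i; rewrite /= h1N ?(ltnW le_N) ?orbT.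
rewrite -/(hsum h1 N1) -/(hsum h2 N2) -/(hsum h N.+1).
rewrite -(hsum_widen hN1 (leq_maxl N1 N2)) -(hsum_widen hN2 (leqW (leq_maxr N1 N2))).
rewrite -/N /hsum.
transitivity (\sum_(i < N.+1) (\sum_(j < N.+1) (s1 i j)%:R * qvar ^+ i * tvar ^+ j
  + \sum_(j < N.+1) (h2 i j)%:R * qvar ^+ i * tvar ^+ j) : Qqt); last first.
  apply: eq_bigr => i _; rewrite -big_split; apply: eq_bigr => j _ /=.
  by rewrite /h natrD !mulrDl.
rewrite big_split /=; congr (_ + _).
rewrite big_ord_recl /= [X in _ = X + _]big1 ?add0r => [|j _]; last by rewrite !mul0r.
rewrite mulr_sumr; apply: eq_bigr => i _; rewrite big_ord_recr /= h1N ?leqnn ?orbT //.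
rewrite !mul0r addr0 mulr_sumr; apply: eq_bigr => j _.
by rewrite /bump /= add1n exprS; ring.
Qed.

Lemma has_Hilb_shift_t P1 P2 P H1 H2 : (forall i m, P2 i 0%N m -> P i 0%N m) ->
  (forall i j m1 m2, P1 i j m1 -> P2 i j.+1 m2 -> P i j.+1 (m1 + m2)%N) ->
  has_Hilb P1 H1 -> has_Hilb P2 H2 -> has_Hilb P (tvar * H1 + H2).
Proof.
move=> P0 PS [h1 [N1 [hP1 hN1 ->]]] [h2 [N2 [hP2 hN2 ->]]].
pose N := maxn N1 N2; pose s1 i j := if j is j'.+1 then h1 i j' else 0%N.
pose h i j := (s1 i j + h2 i j)%N.
have h1N i j : (N <= i)%N || (N <= j)%N -> h1 i j = 0%N.
  by move=> le_N; apply: hN1; case/orP: le_N; rewrite geq_max => /andP[-> _]; rewrite ?orbT.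
have h2N i j : (N <= i)%N || (N <= j)%N -> h2 i j = 0%N.
  by move=> le_N; apply: hN2; case/orP: le_N; rewrite geq_max => /andP[_ ->]; rewrite ?orbT.
exists h, N.+1; split=> [i [|j]|i j|].
- exact: P0.
- exact: PS.
- case/orP=> le_N; rewrite /h h2N ?(ltnW le_N) ?orbT ?addn0 //.
    by case: j => // j; rewrite /= h1N ?(ltnW le_N).
  by case: j le_N => // j le_N; rewrite /= h1N // -[(N <= j)%N]ltnS le_N orbT.
rewrite -/(hsum h1 N1) -/(hsum h2 N2) -/(hsum h N.+1).
rewrite -(hsum_widen hN1 (leq_maxl N1 N2)) -(hsum_widen hN2 (leqW (leq_maxr N1 N2))).
rewrite -/N /hsum.
transitivity (\sum_(i < N.+1) (\sum_(j < N.+1) (s1 i j)%:R * qvar ^+ i * tvar ^+ j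
  + \sum_(j < N.+1) (h2 i j)%:R * qvar ^+ i * tvar ^+ j) : Qqt); last first.
  apply: eq_bigr => i _; rewrite -big_split; apply: eq_bigr => j _ /=.
  by rewrite /h natrD !mulrDl.
rewrite big_split /=; congr (_ + _).
rewrite [RHS]big_ord_recr /= [X in _ = _ + X]big1 ?addr0 => [|j _]; last first.
  by rewrite /s1; case: (nat_of_ord j) => [|j']; rewrite ?h1N ?leqnn ?mul0r.
rewrite mulr_sumr; apply: eq_bigr => i _; rewrite big_ord_recl /= !mul0r add0r.
rewrite mulr_sumr; apply: eq_bigr => j _.
by rewrite /bump /= add1n exprS; ring.
Qed.

End HilbertSeries.

(** * One deletion-restriction step in a fixed bidegree *)

Section GradedPieces.
Variables (F : fieldType) (L : vectType F) (n : nat).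
Variable ell : 'I_n -> 'Hom(L, F^o).
Hypothesis char0 : forall n, n.+1%:R != 0 :> F.
Notation Psi := (superspace F (\dim {:L})).
Notation rhoA := (rhoA ell).
Notation essential := (essential ell).
Notation J := (@J F L).
Implicit Types (x y z : Psi) (u v w : L) (W : {vspace L})
  (N : L -> Prop) (s : seq L) (A B : {set 'I_n}) (f : 'I_n).

Lemma bihomogP i j x : bihomog i j x <-> ssproj i j x = x.
Proof. by split=> [|<-]; [exact: ssproj_id | exact: bihomog_ssproj]. Qed.

Definition piece W i j x := symin W x /\ bihomog i j x.

Lemma linpred_piece W i j : linpred (piece W i j).
Proof.
split=> [|x y [hx /bihomogP ex] [hy /bihomogP ey]|a x [hx /bihomogP ex]].
- by split; [exact: symin0 | apply/bihomogP; rewrite linear0].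
- by split; [exact: syminD | apply/bihomogP; rewrite linearD /= ex ey].
- by split; [exact: syminZ | apply/bihomogP; rewrite linearZ /= ex].
Qed.

Lemma linpred_J W rho N : linpred (J W rho N).
Proof.
split=> [|x y hx hy|a x hx]; [exact: J0 | exact: JD | exact: JZ].
Qed.

Lemma dimv_cap_lker W f : (exists2 v, v \in W & ell f v != 0) ->
  \dim W = (\dim (W :&: lker (ell f))).+1.
Proof.
move=> [v vW fv]; rewrite -(limg_ker_dim (ell f) W) -[RHS]addn1; congr (_ + _)%N.
apply/eqP; rewrite eqn_leq; apply/andP; split.
  by apply: leq_trans (dimvS (subvf _)) _; rewrite dimvf.
rewrite lt0n dimv_eq0; apply: contraNneq fv => W0.
by rewrite -memv0 -W0 memv_img.
Qed.

Section Step.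
Variables (W : {vspace L}) (A : {set 'I_n}) (f : 'I_n) (s : seq L).
Hypotheses (fA : f \in A) (ess : essential W A)
  (sA : forall v i, v \in s -> i \in A -> ell i v = 0).
Notation Ns := (fun v : L => v \in s).
Notation W' := (W :&: lker (ell f))%VS.

Lemma J_lker_sub x : J W' (rhoA (A :\ f)) Ns x -> J W (rhoA A) Ns x.
Proof.
apply: J_mono; [exact: capvSl | move=> v | by left].
by rewrite memv_cap memv_ker => /andP[_ /eqP fv] _; rewrite rhoA_del.
Qed.

Lemma J_lker_restriction x : symin W' x -> J W (rhoA A) Ns x ->
  J W' (rhoA A) (fun v => v \in s \/ coloopdir ell W A v) x.
Proof.
move=> hx Jx; apply: (@J_restriction _ _ _ ell char0 W Ns A W' [set f]) => //.
  by rewrite sub1set.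
move=> w; rewrite memv_cap memv_ker; split=> [/andP[wW /eqP fw]|[wW wf]].
  by split=> // i /set1P->.
by rewrite wW wf ?set11 //=.
Qed.

Lemma dim_mod_loop i j m : (forall w, w \in W -> ell f w = 0) ->
  dim_mod (piece W i j) (J W (rhoA (A :\ f)) Ns) m ->
  dim_mod (piece W i j) (J W (rhoA A) Ns) m.
Proof.
move=> fW; apply: dim_mod_transfer => //; try exact: linpred_J; try exact: linpred_piece.
  by move=> x hx; exists x => //; rewrite subrr; apply: J0.
move=> y _; split; apply: J_mono => // v; try (by left);
  by move=> vW _; rewrite rhoA_del ?fW.
Qed.

(** Both u and theta_u = du are in the ideal because rho u = 1. Subtracting a multiple of u brings
    an element to the ring over [W'], while theta_u has to be recorded in the list. *)
Lemma dim_mod_coloop u i j m : u \in W -> ell f u != 0 ->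
  (forall e, e \in A -> e != f -> ell e u = 0) ->
  dim_mod (piece W' i j) (J W' (rhoA (A :\ f)) (fun v => v \in u :: s)) m ->
  dim_mod (piece W i j) (J W (rhoA A) Ns) m.
Proof.
move=> uW fu uA; have ru : rhoA A u = 1%N by apply: rhoA1I fu uA.
have u0 : u != 0 by apply: contra_neq fu => ->; rewrite linear0.
have Ju y : symin W y -> J W (rhoA A) Ns (sv u * y).
  by move=> hy; rewrite -[sv u]expr1; apply: Jpow_ge; rewrite ?ru.
apply: dim_mod_transfer; try exact: linpred_J; try exact: linpred_piece.
- by move=> x [hx ?]; split=> //; apply: symin_sub hx; apply: capvSl.
- move=> x [hx /bihomogP ex].
  have [y hy ey] := euler_solve char0 0 uW fu (symin_dl (ell f) hx).
  exists (ssproj i j (x - sv u * y)).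
    split; last exact: bihomog_ssproj.
    apply/symin_ssproj/(symin_cap uW fu); first by apply/syminD/syminN/symin_sv.
    by rewrite linearB /= dl_sv -ey mul1r subrr.
  by rewrite linearB /= ex subKr; apply/J_ssproj/Ju.
- move=> y [hy _]; split.
    move/(J_lker_restriction hy) => Jy.
    (* A coloop direction killed by [f] lies in [W'] and is absorbed with rho 1. On any other one
       [f] is the only nonzero form, so it is a multiple of u. *)
    have Jy' : J W' (rhoA (A :\ f)) (fun v => v \in s \/ exists c, v = c *: u) y.
      apply: J_mono Jy => // [v vW' _|v [vs|[vW rv]]]; first last.
      - have [fv|fv] := eqVneq (ell f v) 0.
          right; rewrite rhoA_del // rv memv_cap vW memv_ker fv eqxx; split=> //.
          by apply: contra_eq_neq rv => ->; rewrite rhoA0.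
        left; right; exists ((ell f v : F) / (ell f u : F)).
        apply: (essential_scale ess) => // i' i'A ni'f; split; first exact: uA.
        have [e [eA ev hv]] := rhoA1P rv.
        have ef : e = f.
          by apply/eqP; apply: contraNT fv => nef; rewrite hv // eq_sym.
        by apply: hv; rewrite // ef.
      - by left; left.
      - by move: vW'; rewrite memv_cap memv_ker => /andP[_ /eqP fv]; rewrite rhoA_del.
    have [a [b [Ja hb ->]]] := J_line_decomp (fun v h => h) Jy'.
    apply: JD; last by apply: Jtv => //; rewrite inE eqxx.
    by apply: J_mono Ja => // v vs; left; rewrite inE vs orbT.
  apply: J_mono => [||v]; first exact: capvSl.
    by move=> v; rewrite memv_cap memv_ker => /andP[_ /eqP fv] _; rewrite rhoA_del.
  by rewrite inE => /orP[/eqP->|]; [right; rewrite ru | left].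
Qed.

Section NonColoop.
Hypothesis essf : essential W (A :\ f).

(** A coloop direction on which [f] is nonzero would have rho 0 for [A :\ f], against essentiality.
    The remaining ones lie in [W'] and are absorbed. *)
Lemma J_lker_noncoloop x : symin W' x ->
  J W (rhoA A) Ns x <-> J W' (rhoA (A :\ f)) Ns x.
Proof.
move=> hx; split; last exact: J_lker_sub.
move/(J_lker_restriction hx); apply: J_mono => // v.
  by rewrite memv_cap memv_ker => /andP[_ /eqP fv] _; rewrite rhoA_del.
case=> [|[vW rv]]; first by left.
have v0 : v != 0 by apply: contra_eq_neq rv => ->; rewrite rhoA0.
have [fv|fv] := eqVneq (ell f v) 0.
  by right; rewrite rhoA_del // rv memv_cap vW memv_ker fv eqxx.
have := essential_rhoA essf vW v0.
by move: rv; rewrite (rhoA_set1D _ _ fA) fv add1n => -[->].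
Qed.

Hypothesis nfW : exists2 v, v \in W & ell f v != 0.

(** In commutative degree 0 every [dl] vanishes, so the ring over [W] and the ring over [W'] have
    the same elements. *)
Lemma dim_mod_noncoloop0 j m :
  dim_mod (piece W' 0 j) (J W' (rhoA (A :\ f)) Ns) m ->
  dim_mod (piece W 0 j) (J W (rhoA A) Ns) m.
Proof.
have [v vW fv] := nfW.
apply: dim_mod_transfer; try exact: linpred_J; try exact: linpred_piece.
- by move=> x [hx ?]; split=> //; apply: symin_sub hx; apply: capvSl.
- move=> x [hx hj]; exists x; last by rewrite subrr; apply: J0.
  split=> //; apply: (symin_cap vW fv) => //.
  by move/bihomogP: hj => <-; apply: dl_ssproj0.
- by move=> y [hy _]; apply: J_lker_noncoloop.
Qed.

(** [dl (ell f)] lowers the commutative degree by one, the origin of the factor q.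
    [J_lker_noncoloop] gives injectivity of the inclusion and [J_dl_lift] exactness in the
    middle. *)
Lemma dim_mod_noncoloop i j m1 m2 :
  dim_mod (piece W i j) (J W (rhoA (A :\ f)) Ns) m1 ->
  dim_mod (piece W' i.+1 j) (J W' (rhoA (A :\ f)) Ns) m2 ->
  dim_mod (piece W i.+1 j) (J W (rhoA A) Ns) (m1 + m2).
Proof.
have [v vW fv] := nfW.
have lker0 y : symin W' y -> dl (ell f) y = 0.
  by apply=> w; rewrite memv_cap memv_ker => /andP[_ /eqP].
apply: (@dim_mod_exact _ _ (dl (ell f)) idfun); try exact: linpred_J; try exact: linpred_piece.
- by move=> x [hx ?]; split=> //; apply: symin_sub hx; apply: capvSl.
- by move=> y [hy _]; apply: J_lker_noncoloop.
- by move=> y [hy _]; rewrite /= lker0 //; apply: J0.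
- move=> x [hx /bihomogP ex]; have [y hy ey] := integrate char0 vW fv hx.
  exists (ssproj i.+1 j y); last by rewrite /= -ssproj_dl ey ex.
  by split; [apply: symin_ssproj | apply: bihomog_ssproj].
- move=> x [hx /bihomogP ex]; split; first exact: symin_dl.
  by apply/bihomogP; rewrite ssproj_dl ex.
- by move=> x _; apply: J_dl => // w i' ws; apply: sA.
- move=> x [hx /bihomogP ex] /(J_dl_lift char0 fA essf vW fv)[z Jz ez].
  exists (x - ssproj i.+1 j z); last by rewrite /= subKr; apply: J_ssproj.
  split; last by apply/bihomogP; rewrite linearB /= ex ssproj_id //; apply: bihomog_ssproj.
  apply: (symin_cap vW fv); last by rewrite linearB /= -ssproj_dl ez ssproj_dl ex subrr.
  by apply/syminD/syminN/symin_ssproj/(J_symin Jz).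
Qed.

End NonColoop.
End Step.
End GradedPieces.

(** * Base case: quotients of the exterior algebra by linear generators *)

Section ExteriorBase.
Variables (F : fieldType) (L : vectType F).
Hypothesis char0 : forall n, n.+1%:R != 0 :> F.
Notation Psi := (superspace F (\dim {:L})).
Implicit Types (x y z : Psi) (u v w : L) (s : seq L) (rho : L -> nat).

Definition tvmul u x : Psi := tv u * x.

Lemma tvmul_is_linear u : linear (tvmul u).
Proof. by move=> a x y; rewrite /tvmul mulrDr scalerAr. Qed.
HB.instance Definition _ u :=
  GRing.isLinear.Build F Psi Psi _ (tvmul u) (tvmul_is_linear u).

Lemma tv_vbasis (k : 'I_(\dim {:L})) : tv (vbasis {:L})`_k = sstheta F k.
Proof.
rewrite -[LHS]mulr1 tvM (bigD1 k) //= big1 ?addr0 => [|i nik].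
  by rewrite coord_free ?(basis_free (vbasisP _)) // eqxx scale1r mulr1.
by rewrite coord_free ?(basis_free (vbasisP _)) // eq_sym (negPf nik) scale0r.
Qed.

Lemma J_span (W : {vspace L}) rho s v y : v \in <<s>>%VS -> symin W y ->
  J W rho (fun w => w \in s) (tv v * y).
Proof.
move=> vs hy; rewrite (coord_span (X := in_tuple s) vs) linear_sum mulr_suml.
apply: J_sum => i; rewrite linearZ /= -scalerAl; apply/JZ/Jtv => //.
by rewrite mem_nth.
Qed.

Lemma dual_form u s : free (u :: s) ->
  exists l : 'Hom(L, F^o), l u = 1 /\ forall v, v \in s -> l v = 0.
Proof.
move=> free_us; pose X := in_tuple (u :: s).
exists (linfun (coord X ord0 : L -> F^o)); split=> [|v vs]; rewrite lfunE /=.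
  by rewrite -[u]/(X`_(ord0 : 'I_(size s).+1)) coord_free.
have ltv : ((index v s).+1 < (size s).+1)%N by rewrite ltnS index_mem.
by rewrite -[v](nth_index 0 vs) -[s`_ _]/(X`_(Ordinal ltv)) coord_free.
Qed.

Lemma J_cons_decomp W rho u s x : J W rho (fun v => v \in u :: s) x ->
  exists a b, [/\ J W rho (fun v => v \in s) a, symin W b & x = a + tv u * b].
Proof.
move=> Jx; apply: (@J_line_decomp _ _ _ _ _ (fun v => v = u)).
  by move=> v ->; exists 1; rewrite scale1r.
by apply: J_mono Jx => // v; rewrite inE => /orP[/eqP->|vs]; left; [right | left].
Qed.

(** Contraction with a form equal to 1 on u and 0 on [s] sends theta_u y to y - theta_u (il l y),
    which exhibits y in the larger ideal. This is the injectivity of multiplication by theta_u. *)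
Lemma J_tv_cons rho u s y : free (u :: s) -> symin 0 y ->
  J 0 rho (fun v => v \in s) (tv u * y) <-> J 0 rho (fun v => v \in u :: s) y.
Proof.
move=> free_us hy; split=> [Jy|Jy].
  have [l [lu ls]] := dual_form free_us.
  have /J_il : J 0 rho (fun v => v \in s) (tv u * y) by [].
  move/(_ l) => Jl; rewrite il_tv lu scale1r in Jl.
  rewrite -(subrK (tv u * il l y) y); apply: JD.
    apply: J_mono (Jl _ ls) => // [v vs|v]; first by left; rewrite inE vs orbT.
    by rewrite memv0 => /eqP->; rewrite linear0.
  by apply: Jtv (symin_il _ hy); rewrite inE eqxx.
have [a [b [Ja _ ->]]] := J_cons_decomp Jy.
by rewrite mulrDr tv_sqrM // addr0; apply: J_tv.
Qed.

Lemma J_cons W rho u s x : J W rho (fun v => v \in s) x ->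
  J W rho (fun v => v \in u :: s) x.
Proof. by apply: J_mono => // v vs; left; rewrite inE vs orbT. Qed.

Lemma dim_mod_exterior0 rho u s i m :
  dim_mod (piece 0 i 0) (J 0 rho (fun v : L => v \in u :: s)) m ->
  dim_mod (piece 0 i 0) (J 0 rho (fun v : L => v \in s)) m.
Proof.
apply: dim_mod_transfer => //; try exact: linpred_J; try exact: linpred_piece.
  by move=> x hx; exists x => //; rewrite subrr; apply: J0.
move=> y [hy /bihomogP ey]; split; first exact: J_cons.
move/J_cons_decomp => [a [b [Ja hb ey']]]; rewrite -ey ey' linearD /= ssproj0_tv addr0.
exact: J_ssproj.
Qed.

Lemma dim_mod_exterior rho u s i j m1 m2 : free (u :: s) ->
  dim_mod (piece 0 i j) (J 0 rho (fun v : L => v \in u :: s)) m1 ->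
  dim_mod (piece 0 i j.+1) (J 0 rho (fun v : L => v \in u :: s)) m2 ->
  dim_mod (piece 0 i j.+1) (J 0 rho (fun v : L => v \in s)) (m1 + m2).
Proof.
move=> free_us d1 d2; rewrite addnC; move: d2 d1.
apply: (@dim_mod_exact _ _ idfun (tvmul u)); try exact: linpred_J; try exact: linpred_piece.
- move=> y [hy /bihomogP ey]; split; first exact: symin_tv.
  by apply/bihomogP; rewrite ssproj_tv ey.
- by move=> y [hy _]; apply: J_tv_cons.
- by move=> y [hy _]; apply: Jtv => //; rewrite inE eqxx.
- by move=> x hx; exists x.
- by [].
- by move=> x _; apply: J_cons.
move=> x [hx /bihomogP ex] /J_cons_decomp[a [b [Ja hb /= eab]]].
exists (ssproj i j b); first by split; [apply: symin_ssproj | apply: bihomog_ssproj].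
by rewrite /= /tvmul -ssproj_tv -{1}ex eab -linearB addrK; apply: J_ssproj.
Qed.

(** When [s] spans, the ideal contains every theta_k and hence every theta_S with S nonempty, so
    only the constant term survives. *)
Lemma J0_full rho s x : <<s>>%VS = fullv -> symin 0 x ->
  J 0 rho (fun v : L => v \in s) (x - ((x set0)@_0) *: 1).
Proof.
move=> span_s hx; rewrite -{1}(symin_const char0 hx) [sseval0 x]ss_sum.
rewrite (bigD1 set0) //= addrAC ffunE.
have -> : ssterm ((x set0)@_0)%:MP set0 - (x set0)@_0 *: 1 = 0 :> Psi.
  apply/ffunP => S; rewrite !ffunE; case: eqP => _; rewrite ?mulr1n ?mulr0n.
    by rewrite -alg_mpolyC subrr.
  by rewrite scaler0 subr0.
rewrite add0r; elim/big_rec: _ => [|S y nS Jy]; first exact: J0.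
apply: JD Jy; have [k kS] : exists k, k \in S by apply/set0Pn.
have -> : ssterm (sseval0 x S) S = tv (vbasis {:L})`_k *
    sseval0 (ssterm ((-1) ^+ inversions [set k] (S :\ k) * sseval0 x S) (S :\ k)).
  rewrite tv_vbasis; apply/ffunP => A; rewrite ssthetaE !ffunE.
  case: (boolP (k \in A)) => kA; last first.
    by case: eqP => [eA|_]; rewrite ?mulr0n //; rewrite eA kS in kA.
  have -> : (A :\ k == S :\ k) = (A == S).
    by apply/eqP/eqP => [e|->] //; rewrite -(setD1K kA) e setD1K.
  case: eqP => [->|_]; last by rewrite !mulr0n mcoeff0 mpolyC0 mulr0.
  rewrite !mulr1n !sign_scale mcoeffZ mcoeffC eqxx mulr1 mpolyCM mul_mpolyC.
  by rewrite scalerA -expr2 sqrr_sign scale1r.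
by apply: J_span; [rewrite span_s memvf | apply: symin_sseval0].
Qed.

Lemma J0_set0 rho (N : L -> Prop) x : J 0 rho N x -> x set0 = 0.
Proof.
elim=> {x} [|x y _ IHx _ IHy|v y|v y|v y _ _]; first by rewrite ffunE.
- by rewrite ffunE IHx IHy addr0.
- by rewrite memv0 => /eqP->; rewrite eqxx.
- by rewrite memv0 => /eqP->; rewrite eqxx.
rewrite tvM sum_ffunE big1 // => k _.
by rewrite ssZE ssthetaE inE scaler0.
Qed.

Lemma bihomog_one : bihomog 0 0 (1 : Psi).
Proof.
have -> : 1 = ssterm 1 set0 :> Psi by [].
split=> S; rewrite ffunE; last by rewrite cards_eq0 => /negPf->.
by case: eqP => _; rewrite ?mulr1n ?mulr0n ?dhomog1 ?dhomog0.
Qed.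

Lemma dim_mod_exterior_full rho s i j : <<s>>%VS = fullv ->
  dim_mod (piece 0 i j) (J 0 rho (fun v : L => v \in s)) ((i == 0%N) && (j == 0%N)).
Proof.
move=> span_s; case: (boolP ((i == 0%N) && (j == 0%N))) => [/andP[/eqP-> /eqP->]|nij] /=.
  exists (fun _ => 1); split.
  - move=> _; split; last exact: bihomog_one.
    by move=> l _; rewrite -(ssproj_id bihomog_one) dl_ssproj0.
  - move=> c; rewrite big_ord1 => /J0_set0; rewrite ssZE => /eqP.
    have -> : (1 : Psi) set0 = 1 by rewrite ffunE eqxx.
    by rewrite scaler_eq0 oner_eq0 orbF => /eqP c0 k; rewrite ord1.
  - move=> w [hw _]; exists (fun _ => (w set0)@_0); rewrite big_ord1.
    exact: J0_full.
exists (fun _ => 0); split=> [[]//|c _ []//|w [hw [hi hj]]].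
exists (fun _ => 0); rewrite big_ord0 subr0.
have -> : w = w - (w set0)@_0 *: 1; last exact: J0_full.
suff -> : (w set0)@_0 = 0 by rewrite scale0r subr0.
case/nandP: nij => [i0|j0]; last by rewrite hj ?mcoeff0 // cards0 eq_sym.
by apply: dhomog_nemf_coeff (hi set0) _; rewrite mf0 eq_sym.
Qed.

Lemma Hilb_exterior rho s : free s ->
  has_Hilb (fun i j => dim_mod (piece 0 i j) (J 0 rho (fun v : L => v \in s)))
    ((1 + tvar) ^+ (\dim {:L} - size s)).
Proof.
move ek: (\dim {:L} - size s)%N => k; elim: k s ek => [|k IHk] s ek free_s.
  have span_s : <<s>>%VS = fullv.
    apply/eqP; rewrite eqEdim subvf /= (eqP free_s).
    by rewrite -subn_eq0 ek.
  exists (fun i j => (i == 0%N) && (j == 0%N) : nat), 1%N; split.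
  - by move=> i j; apply: dim_mod_exterior_full.
  - by move=> [|i] [|j].
  - by rewrite !big_ord1 /= !mulr1.
have [u _ us] : exists2 u, u \in {:L}%VS & u \notin <<s>>%VS.
  apply/subvPn; apply/negP => sub; have := dimvS sub.
  by rewrite (eqP free_s) leqNgt -subn_gt0 ek.
have free_us : free (u :: s) by rewrite free_cons us.
rewrite exprS mulrDl mul1r addrC; have H := IHk (u :: s) _ free_us.
apply: has_Hilb_shift_t; last 2 first.
- by apply: H; rewrite /= subnS ek.
- by apply: H; rewrite /= subnS ek.
- by move=> i m; apply: dim_mod_exterior0.
- by move=> i j m1 m2; apply: dim_mod_exterior.
Qed.

End ExteriorBase.

Lemma qvar_neq0 : qvar != 0.
Proof. by rewrite /qvar tofrac_eq0 polyC_eq0 polyX_eq0. Qed.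

Lemma onem_qvar_neq0 : 1 - qvar != 0.
Proof.
rewrite /qvar -tofrac1 -tofracB tofrac_eq0 -polyC1 -polyCB polyC_eq0.
apply/eqP => /(congr1 (horner^~ 0))/eqP.
by rewrite !hornerE /= ?subr0 oner_eq0.
Qed.

Lemma onep_tvar_neq0 : 1 + tvar != 0.
Proof.
rewrite /tvar -tofrac1 -tofracD tofrac_eq0.
apply/eqP => /(congr1 (horner^~ 0))/eqP.
by rewrite !hornerE /= oner_eq0.
Qed.

(** * The deletion-restriction recursion *)

Section HilbertSeriesOfPieces.
Variables (F : fieldType) (L : vectType F) (n : nat).
Variable ell : 'I_n -> 'Hom(L, F^o).
Hypothesis char0 : forall n, n.+1%:R != 0 :> F.
Notation rhoA := (rhoA ell).
Notation essential := (essential ell).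
Notation cap_hyp := (cap_hyp ell).
Implicit Types (u v w : L) (W : {vspace L}) (s : seq L) (A B : {set 'I_n}) (f : 'I_n).

(** If some u killed by the tail [l] has g u nonzero, then h u is nonzero and g - (g u / h u) h
    vanishes on the common kernel of the tail. *)
Lemma form_in_span (l : seq 'Hom(L, F^o)) (g : 'Hom(L, F^o)) :
  (forall w, (forall h, h \in l -> h w = 0) -> g w = 0) -> g \in <<l>>%VS.
Proof.
elim: l g => [|h l IHl] g gl.
  have -> : g = 0 by apply/lfunP => w; rewrite lfunE /= gl.
  exact: mem0v.
pose K := (\bigcap_(k <- l) lker k)%VS.
have KP w : reflect (forall k, k \in l -> k w = 0) (w \in K).
  apply: (iffP idP) => [wK k kl|wl].
    apply/eqP; rewrite -memv_ker; move: wK; rewrite /K (big_rem k) //= memv_cap.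
    by case/andP.
  rewrite /K big_seq; elim/big_rec: _ => [|k U kl]; first exact: memvf.
  by rewrite memv_cap memv_ker wl // eqxx.
have [gK|ngK] := boolP (K <= lker g)%VS.
  rewrite span_cons; apply: (subvP (addvSr _ _)); apply: IHl => w wl.
  by apply/eqP; rewrite -memv_ker; apply: (subvP gK); apply/KP.
have [u /KP ul gu] : exists2 u, u \in K & g u != 0.
  by have /subvPn[u uK] := ngK; exists u; rewrite // -memv_ker.
have hu : h u != 0.
  apply: contra_neq gu => hu0; apply: gl => k.
  by rewrite inE => /orP[/eqP->|/ul].
pose c : F := (g u : F) / (h u : F).
rewrite -(subrK (c *: h) g) addrC span_cons memv_add //; first by rewrite memvZ ?memv_line.
apply: IHl => w wl; rewrite -scaleNr addrC lform_comb.
pose w' := w - ((h w : F) / (h u : F)) *: u.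
have gw' : g w' = 0.
  apply: gl => k; rewrite inE => /orP[/eqP->|kl].
    by rewrite linearB /= lformZ divfK // subrr.
  by rewrite linearB /= lformZ (wl k kl) (ul k kl) mulr0 subrr.
move: gw'; rewrite linearB /= lformZ => /eqP; rewrite subr_eq0 => /eqP->.
have -> : (h w : F) / (h u : F) * g u = c * h w :> F.
  by rewrite /c mulrAC [RHS]mulrAC (mulrC (g u : F)).
by rewrite mulNr addNr.
Qed.

(** Each further form either contains the current intersection in its kernel, and then lies in the
    span of the earlier ones, or lowers the dimension and raises the rank by one. *)
Lemma dim_cap_hyp_rk B : (\dim (cap_hyp fullv B) + rk ell B = \dim {:L})%N.
Proof.
pose Kl (l : seq 'I_n) := foldr (fun i V => V :&: lker (ell i))%VS fullv l.
have KlP l w : reflect (forall i, i \in l -> ell i w = 0) (w \in Kl l).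
  elim: l => [|i l IHl] /=; first by rewrite memvf; constructor.
  rewrite memv_cap memv_ker; apply: (iffP andP) => [[/IHl wl /eqP wi] k|wl].
    by rewrite inE => /orP[/eqP->|/wl].
  split; last by rewrite wl ?inE ?eqxx.
  by apply/IHl => k kl; rewrite wl // inE kl orbT.
have -> : cap_hyp fullv B = Kl (enum B).
  apply/vspaceP => w; apply/cap_hypP/KlP => [[_ wB] i|wB].
    by rewrite mem_enum; apply: wB.
  by split=> [|i iB]; rewrite ?memvf // wB // mem_enum.
rewrite /rk /image_mem; elim: (enum B) => [|i l IHl] /=.
  by rewrite span_nil dimv0 addn0.
have [il|nil] := boolP (Kl l <= lker (ell i))%VS.
  have -> : (Kl l :&: lker (ell i) = Kl l)%VS by apply/capv_idPl.
  have il' : ell i \in <<[seq ell k | k <- l]>>%VS.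
    apply: form_in_span => w wl; apply/eqP; rewrite -memv_ker; apply: (subvP il).
    by apply/KlP => k kl; apply: wl; apply: map_f.
  by rewrite span_cons (addv_idPr _) // -memvE.
have nil' : ell i \notin <<[seq ell k | k <- l]>>%VS.
  apply: contraNN nil => /(coord_span (X := in_tuple _)) ei; apply/subvP => w /KlP wl.
  rewrite memv_ker ei sum_lfunE big1 // => k _; rewrite scale_lfunE.
  have := mem_nth 0 (ltn_ord k : (k < size [seq ell k | k <- l])%N).
  by case/mapP => k' k'l ->; rewrite wl // scaler0.
rewrite -IHl (dimv_cap_lker (not_sub_lkerP _ _ _ nil)) addSn -addnS; congr (_ + _)%N.
rewrite span_cons dimv_disjoint_sum; last first.
  apply/eqP; rewrite -subv0; apply/subvP => g; rewrite memv_cap memv0 => /andP[/vlineP[c ->]].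
  apply: contraLR => cg; have c0 : c != 0 by apply: contraNneq cg => ->; rewrite scale0r.
  apply: contraNN nil' => /(memvZ c^-1); rewrite scalerA mulVf // scale1r.
  by [].
rewrite dim_vline; have -> : ell i != 0 by apply: contraNneq nil' => ->; apply: mem0v.
by rewrite add1n.
Qed.

Lemma rk_le_card B : (rk ell B <= #|B|)%N.
Proof. by apply: leq_trans (dim_span _) _; rewrite size_map -cardE. Qed.

(** * The Tutte side of the recursion *)

Section HilbertExpression.
Variables (K : fieldType) (q t : K).
Hypotheses (q0 : q != 0) (q1 : 1 - q != 0) (t1 : 1 + t != 0).

Definition yfactor : K := (1 - q) / q.
Definition xfactor : K := - t / (1 + t).

(* tutte_sum W A is (y - 1) ^ \dim W times the Tutte polynomial of the forms
   ell i, i \in A, restricted to W, at x - 1 = xfactor and y - 1 = yfactor. *)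
Definition tutte_sum W A : K :=
  \sum_(B : {set 'I_n} | B \subset A)
    yfactor ^+ #|B| * (xfactor * yfactor) ^+ \dim (cap_hyp W B).

(** The power of 1 - q turns the factor (y - 1) ^ dim W of [tutte_sum] into q ^ - dim W. The
    exponent of 1 + t starts from the dimension of the whole space, since restriction to [W] keeps
    all theta variables; each coloop direction in [s] removes one. *)
Definition hilb_expr W A s : K :=
  (1 + t) ^+ (\dim {:L} - size s) * q ^+ #|A| * (1 - q) ^- \dim W
    * tutte_sum W A.

Lemma cap_hypU1 W f B : cap_hyp W (f |: B) = cap_hyp (W :&: lker (ell f)) B.
Proof.
apply/vspaceP => v; apply/cap_hypP/cap_hypP.
  move=> [vW vB]; split; last by move=> i iB; rewrite vB // !inE iB orbT.
  by rewrite memv_cap vW memv_ker vB ?inE ?eqxx.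
rewrite memv_cap memv_ker => -[/andP[vW /eqP vf] vB]; split=> // i.
by rewrite !inE => /orP[/eqP->|/vB].
Qed.

Lemma tutte_sum_rec W A f : f \in A ->
  tutte_sum W A = tutte_sum W (A :\ f) + yfactor * tutte_sum (W :&: lker (ell f)) (A :\ f).
Proof.
move=> fA; rewrite /tutte_sum (bigID (fun B : {set 'I_n} => f \notin B)) /=; congr (_ + _).
  by apply: eq_bigl => B; rewrite subsetD1.
rewrite mulr_sumr (reindex_onto (fun B => f |: B) (fun B => B :\ f)) /=; last first.
  by move=> B /andP[_]; rewrite negbK; apply: setD1K.
apply: eq_big => [B|B].
  rewrite subsetD1 subUset sub1set fA setU11 andbT /=; congr (_ && _).
  apply/eqP/idP => [<-|fB]; last exact: setU1K.
  by rewrite !inE eqxx.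
rewrite subUset sub1set fA setU11 andbT /= => /andP[_ /eqP eB].
have fB : f \notin B by rewrite -eB !inE eqxx.
by rewrite cardsU1 fB exprD expr1 mulrA cap_hypU1.
Qed.

Lemma hilb_expr_loop W A f s : f \in A -> (forall w, w \in W -> ell f w = 0) ->
  hilb_expr W A s = hilb_expr W (A :\ f) s.
Proof.
move=> fA fW; have Wf : (W :&: lker (ell f) = W)%VS.
  by apply/capv_idPl/subvP => w /fW fw; rewrite memv_ker fw.
rewrite /hilb_expr (tutte_sum_rec W fA) Wf (cardsD1 f A) fA.
set T := tutte_sum W _; set a := _ ^+ (_ - _); set b := _ ^- _.
rewrite exprS /yfactor; field; exact: q0.
Qed.

Lemma hilb_expr_noncoloop W A f s : f \in A -> (exists2 v, v \in W & ell f v != 0) ->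
  hilb_expr W A s =
  q * hilb_expr W (A :\ f) s + hilb_expr (W :&: lker (ell f)) (A :\ f) s.
Proof.
move=> fA nf; rewrite /hilb_expr (tutte_sum_rec W fA) (dimv_cap_lker nf) (cardsD1 f A) fA.
rewrite !add1n !exprS !invfM /yfactor.
set T := tutte_sum W _; set T' := tutte_sum _ _.
set a := _ ^+ (_ - _); set b := _ ^- _; set c := _ ^+ #|_|.
field; by rewrite q0 q1.
Qed.

(** Every intersection [cap_hyp W B] with B in [A :\ f] contains u, so H_f lowers its dimension by
    one. The recursion then gives yfactor (1 + xfactor) = yfactor / (1 + t), which takes away one
    power of 1 + t. *)
Lemma hilb_expr_coloop W A f u s : f \in A -> u \in W -> ell f u != 0 ->
  (forall e, e \in A -> e != f -> ell e u = 0) -> (size s < \dim {:L})%N ->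
  hilb_expr W A s = hilb_expr (W :&: lker (ell f)) (A :\ f) (u :: s).
Proof.
move=> fA uW fu uA lts; rewrite /hilb_expr (tutte_sum_rec W fA) (cardsD1 f A) fA.
have -> : tutte_sum W (A :\ f) =
    xfactor * yfactor * tutte_sum (W :&: lker (ell f)) (A :\ f).
  rewrite mulr_sumr; apply: eq_bigr => B sB.
  have -> : (cap_hyp (W :&: lker (ell f)) B = cap_hyp W B :&: lker (ell f))%VS.
    by rewrite /cap_hyp -!capvA [(lker _ :&: _)%VS]capvC.
  rewrite (@dimv_cap_lker _ _ _ ell (cap_hyp W B) f) ?exprS; last first.
    exists u => //; apply/cap_hypP; split=> // e /(subsetP sB).
    by rewrite !inE => /andP[nef eA]; apply: uA.
  by rewrite mulrCA.
have -> : (\dim W = (\dim (W :&: lker (ell f))).+1) by apply: dimv_cap_lker; exists u.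
rewrite /= -(subnSK lts) !add1n !exprS !invfM /yfactor /xfactor.
set T := tutte_sum _ _.
set a := _ ^+ (_ - _); set b := _ ^- _; set c := _ ^+ #|_|.
field; by rewrite q0 q1 t1.
Qed.

Lemma hilb_expr_tutte :
  hilb_expr fullv setT [::] =
  (1 + t) ^+ \dim {:L} * q ^ (n%:Z - (\dim {:L})%:Z) * tutte ell (1 + t)^-1 q^-1.
Proof.
rewrite /hilb_expr subn0 cardsT card_ord -!mulrA; congr (_ * _).
have -> : q ^ (n%:Z - (\dim {:L})%:Z) = q ^+ n / q ^+ \dim {:L}.
  by rewrite expfzDr // -exprnN.
rewrite -mulrA; congr (_ * _).
rewrite /tutte /tutte_sum !mulr_sumr; apply: eq_big => [B|B _]; first by rewrite subsetT.
have -> : (1 + t)^-1 - 1 = xfactor by rewrite /xfactor; field.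
have -> : q^-1 - 1 = yfactor by rewrite /yfactor; field.
have ek := dim_cap_hyp_rk B; have le_rk := rk_le_card B.
rewrite -ek addnK; move: le_rk {ek}.
move: (\dim (cap_hyp fullv B)) (rk ell B) #|B| => k m a le_rk.
rewrite -(subnK le_rk) addnK; move: (a - m)%N => d.
(* With 1 - q eliminated, both sides are monomials in x, y and q. *)
have eq1 : 1 - q = yfactor * q by rewrite /yfactor divfK.
have y0 : yfactor != 0 by rewrite mulf_neq0 // invr_eq0.
move: yfactor y0 eq1 xfactor => y y0 -> x; rewrite !exprMn !exprD.
have yk : y ^+ k != 0 by rewrite expf_neq0.
have ym : y ^+ m != 0 by rewrite expf_neq0.
have qk : q ^+ k != 0 by rewrite expf_neq0.
have qm : q ^+ m != 0 by rewrite expf_neq0.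
by field; rewrite yk ym qk qm.
Qed.

End HilbertExpression.

Lemma Hilb_piece A W s : essential W A ->
  (forall v i, v \in s -> i \in A -> ell i v = 0) -> free s ->
  has_Hilb (fun i j => dim_mod (piece W i j) (J W (rhoA A) (fun v => v \in s)))
    (hilb_expr qvar tvar W A s).
Proof.
have [m] := ubnP #|A|; elim: m => // m IH in A W s * => ltm ess sA free_s.
have [A0|[f fA]] := set_0Vmem A.
  have W0 : W = 0%VS.
    apply/eqP; rewrite -subv0; apply/subvP => w wW; rewrite memv0; apply/eqP.
    by apply: ess => // i; rewrite A0 inE.
  rewrite W0 A0 /hilb_expr cards0 dimv0 expr0 invr1 !mulr1.
  rewrite /tutte_sum (big_pred1 set0) => [|B]; last by rewrite subset0.
  have -> : cap_hyp 0 set0 = 0%VS by rewrite /cap_hyp cap0v.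
  by rewrite cards0 dimv0 !expr0 !mulr1; apply: Hilb_exterior.
have ltA : (#|A :\ f| < m)%N by rewrite -ltnS; apply: leq_trans ltm; rewrite (cardsD1 f A) fA.
have sAf v i : v \in s -> i \in A :\ f -> ell i v = 0.
  by move=> vs; rewrite !inE => /andP[_]; apply: sA.
have [fW|nfW] := boolP (W <= lker (ell f))%VS.
  have fW0 w : w \in W -> ell f w = 0 by move=> /(subvP fW); rewrite memv_ker => /eqP.
  rewrite (hilb_expr_loop tvar qvar_neq0 s fA fW0).
  have essf : essential W (A :\ f).
    move=> w wW wA; apply: ess => // i iA; case: (eqVneq i f) => [->|nif]; first exact: fW0.
    by apply: wA; rewrite !inE nif.
  by apply: has_Hilb_imp (IH _ _ _ ltA essf sAf free_s) => i j k; apply: dim_mod_loop.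
have nf := not_sub_lkerP _ _ _ nfW.
have ess' : essential (W :&: lker (ell f)) (A :\ f).
  move=> w; rewrite memv_cap memv_ker => /andP[wW /eqP fw] wA; apply: ess => // i iA.
  by case: (eqVneq i f) => [->|nif] //; apply: wA; rewrite !inE nif.
have [nK|K] := boolP (~~ (cap_hyp W (A :\ f) <= lker (ell f))%VS).
  have [u /cap_hypP[uW uAf] fu] := not_sub_lkerP _ _ _ nK.
  have uA e : e \in A -> e != f -> ell e u = 0.
    by move=> eA nef; apply: uAf; rewrite !inE nef.
  (* [f] vanishes on [s] but not on u. *)
  have free_us : free (u :: s).
    rewrite free_cons free_s andbT; apply: contraNN fu => us.
    rewrite (coord_span (X := in_tuple s) us) linear_sum big1 // => i _.
    by rewrite linearZ /= (sA _ f) ?scaler0 // mem_nth.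
  have lts : (size s < \dim {:L})%N.
    by have := free_us; rewrite /free => /eqP/= <-; apply/dimvS/subvf.
  rewrite (hilb_expr_coloop qvar_neq0 onem_qvar_neq0 onep_tvar_neq0 fA uW fu uA lts).
  have sA' v i : v \in u :: s -> i \in A :\ f -> ell i v = 0.
    by rewrite inE => /orP[/eqP->|]; [apply: uAf | apply: sAf].
  apply: has_Hilb_imp (IH _ _ _ ltA ess' sA' free_us) => i j k.
  exact: dim_mod_coloop.
move: K; rewrite negbK => /subvP K.
have essf : essential W (A :\ f).
  move=> w wW wA; apply: ess => // i iA.
  case: (eqVneq i f) => [->|nif]; last by apply: wA; rewrite !inE nif.
  by apply/eqP; rewrite -memv_ker; apply: K; apply/cap_hypP.
rewrite (hilb_expr_noncoloop tvar qvar_neq0 onem_qvar_neq0 s fA nf).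
apply: has_Hilb_shift_q (IH _ _ _ ltA essf sAf free_s) (IH _ _ _ ltA ess' sAf free_s).
  by move=> j k; apply: dim_mod_noncoloop0.
by move=> i j m1 m2; apply: dim_mod_noncoloop.
Qed.

End HilbertSeriesOfPieces.

(** * The differential closure *)

Section DifferentialClosure.
Variables (F : fieldType) (L : vectType F) (n : nat).
Variable ell : 'I_n -> 'Hom(L, F^o).
Hypothesis char0 : forall n, n.+1%:R != 0 :> F.
Notation Psi := (superspace F (\dim {:L})).
Notation J := (J fullv (rho ell) (fun v : L => v \in [::])).
Implicit Types (x y z : Psi) (u v w : L).

HB.instance Definition _ :=
  GRing.isLinear.Build F Psi Psi _ (@ssd F (\dim {:L})) (@ssd_linear F (\dim {:L})).

Lemma sssymD (p q : {mpoly F[\dim {:L}]}) : sssym (p + q) = sssym p + sssym q.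
Proof. by apply/ffunP => S; rewrite !ffunE mulrnDl. Qed.

Lemma sssym_neq0 (p : {mpoly F[\dim {:L}]}) (S : {set 'I_(\dim {:L})}) :
  #|S| != 0%N -> sssym p S = 0.
Proof. by rewrite ffunE cards_eq0 => /negPf->. Qed.

Lemma sssymX v k : sssym (symv v ^+ k) = sv v ^+ k.
Proof. by elim: k => // k IHk; rewrite !exprS sssymM IHk. Qed.

Lemma ssd_tv v : ssd (tv v) = 0.
Proof.
by rewrite linear_sum big1 // => k _; rewrite linearZ /= ssd_theta scaler0.
Qed.

Lemma ssd_svM v x : ssd (sv v * x) = tv v * x + sv v * ssd x.
Proof.
by rewrite (@ssd_leibniz _ _ 0) ?scale1r ?ssd_symv // => S; apply: sssym_neq0.
Qed.

Lemma ssd_svX v k : ssd (sv v ^+ k) = k%:R *: (sv v ^+ k.-1 * tv v).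
Proof.
elim: k => [|k IHk].
  rewrite scale0r expr0 -[1]mulr1 /ssd big1 // => k _.
  have -> : ssderiv k (1 * 1 : Psi) = 0; last by rewrite mulr0.
  apply/ffunP => S; rewrite mulr1 !ffunE; case: eqP => _; rewrite ?mulr0n ?linear0 //.
  by rewrite mulr1n -mpolyC1 mderivC.
rewrite exprS ssd_svM IHk -svXC -scalerAr -natr1 scalerDl scale1r addrC; congr (_ + _).
by case: k {IHk} => [|k]; rewrite ?scale0r //= mulrA exprS.
Qed.

(** d sends v ^ rho to a multiple of v ^ (rho - 1) theta_v, and kills the latter since theta_v
    squares to 0. The remaining terms only differentiate the cofactor. *)
Lemma ssd_J x : J x -> J (ssd x).
Proof.
elim=> {x} [|x y _ IHx _ IHy|v y vW v0 _|v y vW v0 _|v y //].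
- by rewrite linear0; apply: J0.
- by rewrite linearD; apply: JD.
- rewrite (@ssd_leibniz _ _ 0); last by move=> S; rewrite -sssymX; apply: sssym_neq0.
  rewrite scale1r; apply: JD; last by apply: Jpow => //; apply: symin_full.
  rewrite ssd_svX -scalerAl -mulrA; apply/JZ/Jdpow => //; exact: symin_full.
- rewrite mulrA (@ssd_leibniz _ _ 1) => [|S cS]; last first.
    rewrite -sssymX sssymE sum_ffunE big1 ?mulr0 // => k _; rewrite ssZE ffunE.
    by case: (eqVneq S [set k]) cS => [->|_ _]; rewrite ?cards1 ?mulr0n ?scaler0.
  rewrite (@ssd_leibniz _ _ 0); last by move=> S; rewrite -sssymX; apply: sssym_neq0.
  rewrite ssd_tv mulr0 scaler0 addr0 ssd_svX -scalerAl.
  have tv2 : tv v * tv v = 0 by rewrite -[X in _ * X]mulr1 tv_sqrM.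
  rewrite -[_ * tv v * tv v]mulrA tv2 mulr0 scaler0 mul0r add0r -mulrA.
  by apply/JZ/Jdpow => //; apply: symin_full.
Qed.

(** Right multiples are immediate from the form of the generators; a left factor crosses theta_v
    after a twist by [ssparity]. *)
Lemma ideal_J : is_ideal J.
Proof.
split=> [|x y|x y|x y]; [exact: J0 | exact: JD | |].
  elim=> {y} [|y z _ IHy _ IHz|v y vW v0 _|v y vW v0 _|v y //].
  - by rewrite mulr0; apply: J0.
  - by rewrite mulrDr; apply: JD.
  - by rewrite mulrA -svXC -mulrA; apply: Jpow => //; apply: symin_full.
  - rewrite (mulrA x) -svXC -mulrA (mulrA x) mul_tv -mulrA.
    by apply: Jdpow => //; apply: symin_full.
elim=> {y} [|y z _ IHy _ IHz|v y vW v0 _|v y vW v0 _|v y //].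
- by rewrite mul0r; apply: J0.
- by rewrite mulrDl; apply: JD.
- by rewrite -mulrA; apply: Jpow => //; apply: symin_full.
- by rewrite -!mulrA; apply: Jdpow => //; apply: symin_full.
Qed.

Lemma power_ideal_J p : power_ideal ell p -> J (sssym p).
Proof.
have [J_0 J_D J_l J_r] := ideal_J.
move=> pi_p; apply: (pi_p (fun p => J (sssym p))) => [|_ [v v0 ->]]; last first.
  rewrite sssymX -[_ ^+ _]mulr1; apply: Jpow => //; first exact: memvf.
  exact: symin_full.
split=> [|a b|a b|a b]; rewrite ?sssymD ?sssymM.
- by have -> : sssym 0 = 0 :> Psi; [apply/ffunP => S; rewrite !ffunE mul0rn | ].
- exact: J_D.
- exact: J_l.
- exact: J_r.
Qed.

(** d (v ^ rho) is rho times v ^ (rho - 1) theta_v, and the positive integer rho is invertible in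
    characteristic 0. So the closure contains both families of generators. *)
Lemma Zideal_J x : (forall v, v != 0 -> (0 < rho ell v)%N) ->
  Zideal ell x <-> J x.
Proof.
move=> rho_gt0; split=> [|Jx I idI symI dI].
  by apply; [exact: ideal_J | exact: power_ideal_J | exact: ssd_J].
have [I0 ID Il Ir] := idI.
have IZ (a : F) y : I y -> I (a *: y).
  by move=> Iy; rewrite -[y]mul1r scalerAl; apply: Il.
have Ipow v : v != 0 -> I (sv v ^+ rho ell v).
  move=> v0; rewrite -sssymX; apply: symI => K _; apply.
  by exists v.
elim: Jx => {x} [|x y _ Ix _ Iy|v y _ v0 _|v y _ v0 _|v y //].
- exact: I0.
- exact: ID.
- exact/Ir/Ipow.
rewrite mulrA; apply: Ir; have := dI _ (Ipow v v0); rewrite ssd_svX.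
case: (rho ell v) (rho_gt0 v v0) => // k _ /(IZ k.+1%:R^-1).
by rewrite scalerA mulVf // scale1r.
Qed.

Lemma rhoA_setT v : rhoA ell setT v = rho ell v.
Proof. by apply: eq_card => i; rewrite !inE /hyp memv_ker. Qed.

End DifferentialClosure.

Theorem corollary1p7 (R : realType) (r n : nat) (L : vectType R[i])
    (dimL : \dim {:L} = r) (ell : 'I_n -> 'Hom(L, R[i]^o))
    (cap0 : (\bigcap_(i < n) hyp ell i = 0)%VS) :
  has_Hilb (Zdim ell)
    ((1 + tvar) ^+ r * qvar ^ (n%:Z - r%:Z)
       * tutte ell (1 + tvar)^-1 qvar^-1).
Proof.
have char0 k : k.+1%:R != 0 :> R[i] by rewrite pnatr_eq0.
have ess : essential ell fullv setT.
  move=> v _ ellv; apply/eqP; rewrite -memv0 -cap0 memvE.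
  by apply/subv_bigcapP => i _; rewrite -memvE memv_ker ellv ?inE.
have rho_gt0 v : v != 0 -> (0 < rho ell v)%N.
  by rewrite -rhoA_setT; apply: essential_rhoA ess (memvf v).
rewrite -dimL -(hilb_expr_tutte ell qvar_neq0 onem_qvar_neq0 onep_tvar_neq0).
have H := @Hilb_piece _ _ _ ell char0 setT fullv [::] ess _ (nil_free _).
apply: has_Hilb_imp (H _) => // i j m [b [Vb free_b span_b]]; exists b.
have JZ_iff w : J fullv (rhoA ell setT) (fun v => v \in [::]) w <-> Zideal ell w.
  apply: iff_trans (iff_sym (Zideal_J char0 _ rho_gt0)).
  by split; apply: J_mono => // v _ _; rewrite rhoA_setT.
split=> [k|c /JZ_iff|w hw]; [by case: (Vb k) | exact: free_b |].
(* Over the full space the condition [symin] in [piece] is automatic, so pieces are the whole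
   bihomogeneous components. *)
have [c Ic] := span_b w (conj (symin_full w) hw).
by exists c; apply/JZ_iff.
Qed.
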